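(* Let $\lambda$ and $\mu$ be partitions with $\mu\subset\lambda$, put $\delta=\lambda/\mu$, let ${\pmb k}\in I_{\delta}^{\mathrm D}$, and let ${\pmb k}^{\dagger}$ be the dual tableau of ${\pmb k}$. Then for every $\ell\in\mathbb{Z}_{\ge 0}$, $$\mathcal{O}({\pmb k}:\ell)=\mathcal{O}({\pmb k}^{\dagger}:\ell).$$
   Context: **Tableaux and Schur multiple zeta values.** Rows are numbered from top to bottom and columns from left to right. For partitions $\mu\subset\lambda$ (i.e. $\mu_i\le\lambda_i$ for all $i$), the skew Young diagram $\delta=\lambda/\mu$ is the set of boxes $(i,j)$ of $\lambda$ not in $\mu$ ($\mu=\emptyset$ is allowed). $T_\delta(X)$ is the set of all fillings of $\delta$ by elements of $X$. $\mathrm{SSYT}_\delta\subset T_\delta(\mathbb{N})$, with $\mathbb N=\{1,2,\dots\}$, is the set of semi-standard tableaux $M=(m_{ij})$: entries weakly increase from left to right along rows and strictly increase from top to bottom down columns. For ${\pmb s}=(s_{ij})\in T_\delta(\mathbb{C})$, $$\zeta_\delta({\pmb s})=\sum_{M\in \mathrm{SSYT}_\delta}\ \prod_{(i,j)\in\delta} m_{ij}^{-s_{ij}},$$ which converges absolutely if $\Re(s_{ij})\ge 1$ for all boxes and $\Re(s_{ij})>1$ for all corners of $\delta$ (boxes $(i,j)\in\delta$ with $(i+1,j)\notin\delta$ and $(i,j+1)\notin\delta$). **The sums $\mathcal{O}$.** For a skew shape $\delta$, a filling ${\pmb k}\in T_\delta(\mathbb{Z}_{\ge1})$ whose entries at all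 corners are $\ge 2$, and $\ell\in\mathbb{Z}_{\ge0}$, $$\mathcal{O}({\pmb k}:\ell):=\sum_{\substack{{\pmb\varepsilon}\in T_\delta(\mathbb{Z}_{\ge 0})\\ |{\pmb\varepsilon}|=\ell}}\zeta_\delta({\pmb k}+{\pmb\varepsilon}),$$ where $|{\pmb\varepsilon}|$ is the sum of all entries of ${\pmb\varepsilon}$ and addition of fillings is entrywise. For ${\pmb k}^\dagger$, the shape used is the shape $\delta^\dagger$ of ${\pmb k}^\dagger$. **Admissible pieces.** For integers $a,b\ge 1$, the admissible piece $A(a,b)$ is the finite sequence $\underbrace{1,\dots,1}_{a-1},b+1$, and its dual is $A(a,b)^\dagger:=A(b,a)$. A sequence of positive integers whose last term is $\ge 2$ (an admissible index) is uniquely a concatenation of admissible pieces $(A_1,\dots,A_m)$; its dual index is $(A_m^\dagger,\dots,A_1^\dagger)$. **The set $I_\delta^{\mathrm D}$.** Let $T_\delta^{\mathrm{diag}}(\mathbb{Z})$ be the set of ${\pmb s}\in T_\delta(\mathbb{Z})$ with $s_{ij}=s_{pq}$ whenever $j-i=q-p$. Then $I_\delta^{\mathrm D}$ is the set of ${\pmb k}=(k_{ij})\in T_\delta^{\mathrm{diag}}(\mathbb{Z})$ such that (1) each non-empty column, read from top to bottom, is a concatenation of admissible pieces (i.e. is an admissible index); and (2) whenever $(r,j)$ is the top box of column $j$ and $(r,j+1)\in\delta$, one has $k_{r,j+1}\neq 1$. **Indexing of pieces.** Let ${\pmb k}\in I_\delta^{\mathrm D}$. Decompose every column into admissible pieces.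 The pieces of column $j$, from top to bottom, are labelled $A_{nj},A_{(n+1)j},\dots,A_{(n+m)j}$ with consecutive first indices, the topmost level of pieces being numbered $1$, in such a way that the top box of $A_{ij}$ and the bottom box of $A_{i(j+1)}$ lie in the same row, side by side, whenever both pieces are non-empty. (If columns $j$ and $j+1$ share no row, all first indices of pieces in column $j$ are larger than those in column $j+1$.) **The dual tableau.** The dual of column $j$ with pieces $A_{nj},\dots,A_{(n+m)j}$ (top to bottom) is the column with pieces $A_{(n+m)j}^\dagger,\dots,A_{nj}^\dagger$ (top to bottom). The dual tableau ${\pmb k}^\dagger$ is obtained by arranging the dual columns in the reversed order, from left to right: the dual of column $\lambda_1$, the dual of column $\lambda_1-1$, ..., the dual of column $1$, where for $2\le j\le\lambda_1$ the top box of $A_{ij}^\dagger$ and the bottom box of $A_{i(j-1)}^\dagger$ are put side by side (in the same row) whenever both are non-empty. If columns $j$ and $j-1$ of ${\pmb k}$ have no common first index $i$, the dual of column $j-1$ is placed in rows strictly above those of the dual of column $j$ (the exact offset does not affect the values of $\zeta_{\delta^\dagger}$). The shape $\delta^\dagger$ of ${\pmb k}^\dagger$ is a skew Young diagram. *)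

(* Defs.v *)
From HB Require Import structures.
From mathcomp Require Import all_boot all_order all_algebra.
From mathcomp Require Import finmap.
From mathcomp Require Import all_classical all_reals all_analysis.

Set Implicit Arguments.
Unset Strict Implicit.
Unset Printing Implicit Defensive.

Import Order.TTheory GRing.Theory Num.Theory.

Local Open Scope nat_scope.

(* Partitions are sequences of positive parts; boxes are pairs (row, column),
   both numbered from 0, so that the i-th part is [nth 0 la i]. *)
Definition is_partition (la : seq nat) : bool :=
  sorted geq la && all (fun p => 0 < p) la.

Definition part_sub (mu la : seq nat) : Prop :=
  forall i, nth 0 mu i <= nth 0 la i.

Definition skew_shape (la mu : seq nat) : {fset nat * nat} :=
  [fset b : nat * nat in
     [seq (i, j) | i <- iota 0 (size la),
                   j <- iota (nth 0 mu i) (nth 0 la i - nth 0 mu i)]]%fset.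

Lemma mem_skew_shape (la mu : seq nat) (i j : nat) :
  ((i, j) \in skew_shape la mu) = (nth 0 mu i <= j < nth 0 la i).
Proof.
rewrite inE /=; apply/allpairsPdep/idP.
  move=> [i' [j' [_ + [-> ->]]]]; rewrite mem_iota => /andP[h1 h2].
  rewrite h1 /=; case: (leqP (nth 0 mu i') (nth 0 la i')) => h.
    by rewrite subnKC in h2.
  by move: h2; rewrite (eqP (ltnW h)) addn0 ltnNge h1.
move=> /andP[h1 h2]; exists i, j; split => //.
  rewrite mem_iota add0n /=; case: ltnP => // h.
  by rewrite nth_default in h2.
by rewrite mem_iota h1 subnKC // ltnW // (leq_ltn_trans h1).
Qed.

Section SchurMZV.
Variables (R : realType) (D : {fset nat * nat}).

(* T_D(X) is {ffun D -> X}. *)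
Definition SSYT : set {ffun D -> nat} :=
  [set M | [/\ forall b : D, 0 < M b,
     forall b c : D, (val b).1 = (val c).1 -> (val b).2 < (val c).2 ->
       M b <= M c &
     forall b c : D, (val b).2 = (val c).2 -> (val b).1 < (val c).1 ->
       M b < M c]].

(* Only exponents that are nonnegative integers are needed; the terms are then
   nonnegative, so the (unordered) sum is taken in the extended reals. *)
Definition zeta (s : {ffun D -> nat}) : \bar R :=
  (\esum_(M in SSYT) (\prod_(b : D) (M b)%:R ^- s b)%:E)%R.

(* The entries of a filling of weight l are at most l, hence lie in 'I_l.+1. *)
Definition Osum (k : {ffun D -> nat}) (l : nat) : \bar R :=
  (\sum_(e : {ffun D -> 'I_l.+1} | (\sum_(b : D) e b == l)%N)
     zeta [ffun b => (k b + e b)%N])%E.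

End SchurMZV.

(* The pair (a, b) with a, b >= 1 stands for the admissible piece A(a, b). *)
Definition piece (p : nat * nat) : seq nat := rcons (nseq p.1.-1 1) p.2.+1.

Definition dual_piece (p : nat * nat) : nat * nat := (p.2, p.1).

Definition is_piece (p : nat * nat) : bool := (0 < p.1) && (0 < p.2).

Definition admissible (s : seq nat) : Prop :=
  exists ps : seq (nat * nat), all is_piece ps /\ s = flatten (map piece ps).

(* Decomposition into pieces; [a.-1] is the number of 1's read since the end of
   the previous piece. *)
Fixpoint pieces_from (a : nat) (s : seq nat) : seq (nat * nat) :=
  if s is x :: s' then
    if x == 1 then pieces_from a.+1 s' else (a, x.-1) :: pieces_from 1 s'
  else [::].

Definition pieces (s : seq nat) : seq (nat * nat) := pieces_from 1 s.

Lemma flatten_pieceK (ps : seq (nat * nat)) :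
  all is_piece ps -> pieces (flatten (map piece ps)) = ps.
Proof.
rewrite /pieces; elim: ps => [//|[a b] ps IH] /= /andP[/andP[/= a0 b0] aps].
rewrite /piece /= cat_rcons.
have H n c t : pieces_from c (nseq n 1 ++ b.+1 :: t) =
               (c + n, b) :: pieces_from 1 t.
  elim: n c => [|n IHn] c /=; first by rewrite eqSS gtn_eqF // addn0.
  by rewrite IHn addSnnS.
by rewrite H add1n prednK // IH.
Qed.

Definition dual_index (s : seq nat) : seq nat :=
  flatten [seq piece (dual_piece p) | p <- rev (pieces s)].

(* A tableau with natural entries is a finite map, whose domain is its shape. *)
Definition tableau := {fmap nat * nat -> nat}.

Section DualTableau.
Variable T : tableau.

Definition entry (i j : nat) : nat := odflt 0 (T.[? (i, j)])%fmap.

(* The rows met by column j, from top to bottom. *)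
Definition column_rows (j : nat) : seq nat :=
  sort leq [seq b.1 | b <- domf T & b.2 == j].

Definition column (j : nat) : seq nat :=
  [seq entry i j | i <- column_rows j].

Definition is_diag : Prop :=
  forall i j p q : nat, (i, j) \in domf T -> (p, q) \in domf T ->
    (j%:Z - i%:Z = q%:Z - p%:Z)%R -> entry i j = entry p q.

(* Integer entries may be taken in nat: condition (1) makes them positive. *)
Definition ID : Prop :=
  [/\ is_diag,
      forall j, admissible (column j) &
      forall r j : nat, (r, j) \in domf T ->
        (forall r' : nat, (r', j) \in domf T -> r <= r') ->
        (r, j.+1) \in domf T -> entry r j.+1 <> 1].

Definition col_pieces (j : nat) : seq (nat * nat) := pieces (column j).

(* The number of pieces of column j+1 whose bottom box lies strictly above all
   the boxes of column j. The bottom box of a piece is its only box with an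
   entry different from 1. *)
Definition pieces_above (j : nat) : nat :=
  count (fun i => (entry i j.+1 != 1) && all (ltn i) (column_rows j))
        (column_rows j.+1).

(* The variable w is the number of columns. *)
Variable w : nat.

(* First index (level) of the topmost piece of column j, computed from the
   rightmost column, which starts at level 1: if columns j and j+1 share a row,
   then the top box of column j lies beside the bottom box of a piece of column
   j+1, and these two pieces get the same level; otherwise column j starts below
   the last level of column j+1. *)
Definition first_level (j : nat) : nat :=
  1 + \sum_(j <= h < w.-1) pieces_above h.

Definition has_level (i j : nat) : bool :=
  first_level j <= i < first_level j + size (col_pieces j).

Definition last_level (j : nat) : nat :=
  (first_level j + size (col_pieces j)).-1.

Definition dual_column (j : nat) : seq nat := dual_index (column j).

(* The number of boxes of the dual of column j which are occupied by the duals
   of the pieces A_{i'j} with i' >= i. These are the topmost pieces, the last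
   one being the dual of A_{ij}. *)
Definition dual_depth (i j : nat) : nat :=
  sumn [seq p.2 | p <- drop (i - first_level j) (col_pieces j)].

(* Top row of the dual of column j; the dual of column 0 starts in row 0.
   When columns j and j+1 have a common level, the bottom piece of column j+1,
   of level i := last_level j.+1, has a counterpart in column j. Its dual is at
   the top of the dual of column j+1, so its top box is put beside the bottom
   box of the dual of A_{ij}; since T is constant along diagonals, the duals at
   all the other common levels are then aligned in the same way.
   When there is no common level, the dual of column j+1 starts immediately
   below the last row of the dual of column j. *)
Fixpoint dual_top (j : nat) : nat :=
  if j is h.+1 then
    let i := last_level j in
    dual_top h + (if has_level i j && has_level i h then (dual_depth i h).-1
                  else size (dual_column h))
  else 0.

(* The dual of column j is placed in column w-1-j. *)
Definition dual_shape : {fset nat * nat} :=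
  [fset b : nat * nat in
     [seq ((dual_top j + u)%N, (w.-1 - j)%N) | j <- iota 0 w,
                                       u <- iota 0 (size (dual_column j))]]%fset.

Definition dual_tableau : tableau :=
  [fmap b : dual_shape =>
     let j := w.-1 - (val b).2 in
     nth 0 (dual_column j) ((val b).1 - dual_top j)]%fmap.

End DualTableau.

(* Main.v *)
Require Import Defs.
From HB Require Import structures.
From mathcomp Require Import all_boot all_order all_algebra.
From mathcomp Require Import fingroup perm finmap.
From mathcomp Require Import all_classical all_reals all_analysis.
From mathcomp Require Import zify ring lra.

Set Implicit Arguments.
Unset Strict Implicit.
Unset Printing Implicit Defensive.

Import Order.TTheory GRing.Theory Num.Theory.
Import numFieldNormedType.Exports.

(** The generating function of the sums [Osum R k l] determines them, since
    they are nonnegative (Lemma [coef_eq]). For [0 <= x <= 1/2], summing over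
    the increments first turns every box into a geometric series, so that the
    condition on their total disappears: the generating function is a sum over
    semi-standard tableaux of products of the box weights
    [1 / ((m - x) * m ^ (k - 1))] (Lemma [esum_Osum]).

    As [k] is constant along diagonals, the weight of a box depends on its
    diagonal and on its entry only. For such weights a Jacobi-Trudi formula
    holds (Lemma [esum_ssyt]): the sum over tableaux is the determinant whose
    entry at [(i, j)] is the sum over a single column, namely the segment of the
    sequence of diagonal values that starts at the top of column [j] and stops
    at the bottom of column [i]. For entries bounded by [N] it follows by
    induction on [N] from the multilinearity of the determinant: a term of the
    expansion is a choice of the columns that end with [N], and the choices that
    do not leave a skew shape give singular matrices.

    For a single column the claim is Ohno's relation in generating function form
    (Lemma [esum_colfun_dual]), proved by the connected sums of Seki and
    Yamamoto: an admissible piece [A(a, b)] acts as [opQ ^ b * opP ^ a] on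
    functions of the last summation variable, and [opP] and [opQ] are adjoint
    to each other for the pairing defined by the connector.

    It remains to compare the two matrices. By the two conditions that define
    [ID], every top of a column starts an admissible piece and every bottom ends
    one (Lemmas [break_sg] and [break_et]), so every segment is a concatenation
    of pieces. The dual tableau is arranged in such a way that its diagonal
    values are the dual of the whole sequence and its columns are cut at the
    dual positions (Lemmas [dual_topE] and [slice_dual_seq]). Hence its segments
    are the duals of the segments of [k], with the roles of tops and bottoms
    exchanged: its matrix is the reflection of the matrix of [k] in the
    antidiagonal, and both have the same determinant. *)

(** * Unordered sums of nonnegative terms *)

Section Esum.
Local Open Scope classical_set_scope.
Local Open Scope ring_scope.
Local Open Scope ereal_scope.
Variable R : realType.

Lemma esumZl (T : choiceType) (I : set T) (c : R) (a : T -> \bar R) :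
  (0 <= c)%R -> (forall i, 0 <= a i) ->
  \esum_(i in I) (c%:E * a i) = c%:E * \esum_(i in I) a i.
Proof.
move=> c0 a0; rewrite /esum -ereal_supZl//; last first.
  by apply/set0P; exists 0, set0; [exact: fsets_set0|rewrite fsbig_set0].
congr ereal_sup; apply/seteqP; split => [_ [X IX <-]|_ [_ [X IX <-] <-]] /=.
  by exists (\sum_(x \in X) a x); [exists X|rewrite ge0_mule_fsumr].
by exists X => //; rewrite ge0_mule_fsumr.
Qed.

Lemma esum_swap (T1 T2 : choiceType) (I : set T1) (J : set T2)
    (a : T1 -> T2 -> \bar R) :
  (forall i j, 0 <= a i j) ->
  \esum_(i in I) \esum_(j in J) a i j = \esum_(j in J) \esum_(i in I) a i j.
Proof.
move=> a0; rewrite (esum_esum (J := fun=> J))// (esum_esum (J := fun=> I))//.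
rewrite (reindex_esum (J `*` I) _ (fun x => (x.2, x.1)))//; split => //=.
- by move=> [i j] [/= ? ?].
- by move=> [i1 i2] [j1 j2] /= _ _ [-> ->].
by move=> [i1 i2] [/= P Q]; exists (i2, i1).
Qed.

Lemma esum_finType (T : finType) (P : pred T) (a : T -> \bar R) :
  (forall i, 0 <= a i) ->
  \esum_(i in [set i | P i]) a i = \sum_(i | P i) a i.
Proof.
move=> a0; rewrite esum_fset//.
rewrite fsbig_finite//= -[RHS]big_enum /=; apply: perm_big.
apply: uniq_perm; rewrite ?fset_uniq ?enum_uniq// => i.
rewrite in_fset_set; last exact: (@finite_finset T).
  by rewrite mem_enum; apply/idP/idP; rewrite inE.
exact: (@finite_finset T).
Qed.

(** A finite set of indices lies in a single member of an exhausting chain, so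
    the sum is the limit of the sums over the members of the chain. *)
Lemma esum_exhaust (T : choiceType) (S : nat -> set T) (I : set T)
    (a : T -> \bar R) (u : nat -> R) (L : R) :
  (forall i, 0 <= a i) ->
  (forall n, S n `<=` I) ->
  (forall i, I i -> exists n, forall m, (n <= m)%N -> S m i) ->
  (forall n, \esum_(i in S n) a i = (u n)%:E) ->
  (u n @[n --> \oo] --> L)%R ->
  \esum_(i in I) a i = L%:E.
Proof.
move=> a0 SI IS Su uL; apply/eqP; rewrite eq_le; apply/andP; split; last first.
  have uL' : (u n)%:E @[n --> \oo] --> L%:E.
    by apply: cvg_EFin => //; exact: nearW.
  rewrite -(cvg_lim _ uL')//; apply: lime_le; first by apply/cvg_ex; exists L%:E.
  apply: nearW => n; rewrite -Su (esum_mkcond I) (esum_mkcond (S n)).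
  apply: le_esum => i _; case: ifPn => [|_]; last by case: ifP.
  by rewrite inE => /SI Ii; rewrite mem_set.
have uL' : (u n)%:E @[n --> \oo] --> L%:E.
  by apply: cvg_EFin => //; exact: nearW.
apply: ge_ereal_sup => _ [X [finX XI] <-].
have [N hN] : exists N, forall m, (N <= m)%N -> X `<=` S m.
  have [N hN] : exists N : T -> nat,
      forall i, I i -> forall m, (N i <= m)%N -> S m i.
    have /choice[N hN] : forall i, exists n, I i -> forall m, (n <= m)%N -> S m i.
      move=> i; have [/IS[n hn]|nI] := pselect (I i); first by exists n.
      by exists 0%N.
    by exists N.
  exists (\max_(i <- fset_set X) N i)%N => m hm i Xi.
  apply: hN; first exact: XI.
  apply: leq_trans hm; apply: leq_bigmax_seq => //.
  by rewrite in_fset_set// mem_set.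
rewrite -(cvg_lim _ uL')//; apply: lime_ge; first by apply/cvg_ex; exists L%:E.
exists N => // m /= hm; rewrite -Su; apply: esum_ge; exists X => //.
by split => //; exact: hN.
Qed.

Lemma esum_nat (a : nat -> R) (L : R) :
  (forall i, (0 <= a i)%R) -> (series a n @[n --> \oo] --> L)%R ->
  \esum_(i in [set: nat]) (a i)%:E = L%:E.
Proof.
move=> a0 aL; rewrite -nneseries_esumT; last by move=> n; rewrite lee_fin.
apply/cvg_lim => //; apply: cvg_EFin.
  by apply: nearW => n; rewrite sumEFin.
by under eq_fun do rewrite /= sumEFin /=.
Qed.

Lemma esum_ltn (a : nat -> R) (m : nat) :
  (forall i, (0 <= a i)%R) ->
  \esum_(i in [set: nat]) (a i * (i < m)%:R)%:E = (\sum_(i < m) a i)%:E.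
Proof.
move=> a0; apply: esum_nat => [i|]; first by rewrite mulr_ge0.
apply: cvg_near_cst; exists m => // n /= mn.
rewrite /series /= big_mkord (big_ord_widen _ _ mn) big_mkcond /=.
rewrite [RHS]big_mkcond /=; apply: eq_bigr => i _.
by case: ifP; rewrite ?mulr1 ?mulr0.
Qed.

Lemma esum_partition (T : choiceType) (I : finType) (S : set T) (g : T -> I)
    (a : T -> \bar R) :
  (forall t, 0 <= a t) ->
  \esum_(t in S) a t = \sum_i \esum_(t in S `&` [set t | g t = i]) a t.
Proof.
move=> a0; under [RHS]eq_bigr do rewrite esum_mkcondr.
rewrite -esum_sum => [|t i _ _]; last by case: ifP.
apply: eq_esum => t St; rewrite (bigD1 (g t))//= ifT; last by rewrite inE.
rewrite big1 ?adde0// => i; rewrite eq_sym => gti.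
by rewrite ifF//; apply/negbTE; rewrite notin_setE /=; apply/eqP.
Qed.

End Esum.

(** * Ohno's relation for one column *)

Section Column.
Local Open Scope classical_set_scope.
Local Open Scope ring_scope.
Variables (R : realType) (x : R).
Hypotheses (x0 : 0 <= x) (x12 : x <= 2^-1).

(** The Pochhammer symbol of [1 - x]. *)
Definition poch (n : nat) : R := \prod_(i < n) (i.+1%:R - x).

(** The connector of Seki and Yamamoto, deformed by [x]. *)
Definition conn (m n : nat) : R := poch m * poch n / poch (m + n).

(** A column is described by the function whose value at [m] is the sum over the
    fillings with bottom entry [m]. [opP] adds a box with exponent [1] below,
    with the factor [1 / (m - x)], and [opQ] increases the exponent of the bottom
    box by [1]. The value at [0] stands for the empty column, so [opP] must
    return [0] there. *)
Definition opP (V : nat -> R) (m : nat) : R :=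
  if m is 0 then 0 else (m%:R - x)^-1 * \sum_(i < m) V i.

Definition opQ (V : nat -> R) (m : nat) : R := V m / m%:R.

(** The empty column. *)
Definition unit0 (m : nat) : R := (m == 0%N)%:R.

Definition pairing (V W : nat -> R) : \bar R :=
  (\esum_(m in [set: nat]) \esum_(n in [set: nat])
     (V m * conn m n * W n)%:E)%R.

Lemma nat_subx_gt0 m : 0 < m.+1%:R - x.
Proof.
have : (1 : R) <= m.+1%:R by rewrite ler1n.
have := x12; lra.
Qed.

Lemma poch_gt0 n : 0 < poch n.
Proof. by apply: prodr_gt0 => i _; exact: nat_subx_gt0. Qed.

Lemma pochS n : poch n.+1 = poch n * (n.+1%:R - x).
Proof. by rewrite /poch big_ord_recr. Qed.

Lemma conn_ge0 m n : 0 <= conn m n.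
Proof. by rewrite /conn !mulr_ge0 ?invr_ge0 ?ltW ?poch_gt0. Qed.

Lemma connC m n : conn m n = conn n m.
Proof. by rewrite /conn addnC [poch m * _]mulrC. Qed.

Lemma conn0 m : conn m 0 = 1.
Proof.
by rewrite /conn addn0 {2}/poch big_ord0 mulr1 divff// gt_eqF ?poch_gt0.
Qed.

(** The connector is chosen such that multiplication by [1 / (m - x)] turns it
    into a difference in [m], for every positive second argument. *)
Lemma connS m n :
  conn m.+1 n.+1 / (m.+1%:R - x) = (conn m n.+1 - conn m.+1 n.+1) / n.+1%:R.
Proof.
rewrite /conn !addSn !pochS addnS pochS.
have h1 := poch_gt0 (m + n); have h2 := nat_subx_gt0 (m + n).
have h3 := nat_subx_gt0 m; have h4 := nat_subx_gt0 (m + n).+1.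
have e : (m + n).+2%:R = m.+1%:R + n.+1%:R :> R by rewrite -natrD addSn addnS.
rewrite e in h4 *; move: h2 h3 h4 h1.
have : (0 : R) < n.+1%:R by rewrite ltr0n.
move: (poch m) (poch n) (poch (m + n)) => a b c.
move: (m.+1%:R : R) (n.+1%:R : R) ((m + n).+1%:R : R) => u v w.
move=> v0 h2 h3 h4 c0; field.
by rewrite !gt_eqF.
Qed.

(** After cancellation the numerator is [poch n.+1], which is independent of [m],
    and the smallest factor of the denominator is [m + 1 - x]. *)
Lemma conn_cvg0 n : (conn m n.+1 @[m --> \oo] --> 0)%classic.
Proof.
have h m : conn m n.+1 <= (poch n.+1 * 2) * harmonic m.
  have e k : poch m / poch (m + k.+1) <= (m.+1%:R - x)^-1.
    elim: k => [|k IH].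
      rewrite addn1 pochS invfM mulrA divff ?mul1r// gt_eqF ?poch_gt0//.
    rewrite addnS pochS invfM mulrA; apply: le_trans IH.
    apply: ler_piMr; first by rewrite divr_ge0 ?ltW ?poch_gt0.
    rewrite invf_le1 ?nat_subx_gt0//.
    have : (2 : R) <= (m + k.+1).+1%:R by rewrite ler_nat; lia.
    have := x12; lra.
  rewrite /conn mulrAC [_ * poch n.+1]mulrC -mulrA.
  apply: ler_wpM2l; first by rewrite ltW ?poch_gt0.
  apply: le_trans (e n) _; rewrite /harmonic /= -[2]invrK -invfM.
  rewrite lef_pV2 ?posrE ?nat_subx_gt0 ?mulr_gt0 ?invr_gt0 ?ltr0n//.
  have : (1 : R) <= m.+1%:R by rewrite ler1n.
  have := x12; lra.
apply: (squeeze_cvgr (f := fun=> 0) (h := fun m => poch n.+1 * 2 * harmonic m)).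
- by apply: nearW => m; rewrite conn_ge0 h.
- exact: cvg_cst.
by rewrite -[X in _ --> X](mulr0 (poch n.+1 * 2)); apply: cvgMr; exact: cvg_harmonic.
Qed.

(** The telescoping sum of [connS], started above [m']. *)
Lemma conn_tail m' n :
  (\esum_(m in [set: nat])
     ((m' < m)%N%:R * (conn m n.+1 / (m%:R - x)))%:E = (conn m' n.+1 / n.+1%:R)%:E)%R.
Proof.
apply: esum_nat => [[|m]|].
- by rewrite ltn0 mul0r.
- by rewrite mulr_ge0 ?ler0n// divr_ge0 ?conn_ge0// ltW// nat_subx_gt0.
(* The maximum covers the partial sums that stop before the first nonzero term. *)
have e N : series (fun m => (m' < m)%N%:R * (conn m n.+1 / (m%:R - x))) N.+1 =
    (conn m' n.+1 - conn (maxn m' N) n.+1) / n.+1%:R.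
  elim: N => [|N IH].
    by rewrite /series /= big_nat1 ltn0 mul0r maxn0 subrr mul0r.
  rewrite /series /= big_nat_recr//=; rewrite /series /= in IH; rewrite {}IH connS.
  case: (boolP (m' < N.+1)%N) => h.
    have /maxn_idPr -> : (m' <= N)%N by [].
    have /maxn_idPr -> : (m' <= N.+1)%N by lia.
    by rewrite mul1r -mulrDl addrA subrK.
  rewrite mul0r addr0.
  have /maxn_idPl -> : (N <= m')%N by lia.
  by have /maxn_idPl -> : (N.+1 <= m')%N by lia.
rewrite -(cvg_shiftS (series _)); under eq_fun do rewrite e.
apply: cvgM; last exact: cvg_cst.
rewrite -[X in _ --> X]subr0; apply: cvgB; first exact: cvg_cst.
apply: cvg_trans (@conn_cvg0 n); apply: near_eq_cvg.
by exists m' => // N /= h; rewrite (maxn_idPr h).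
Qed.

Local Notation nonneg V := (forall m : nat, (0 : R) <= V m).

Lemma opP_ge0 V : nonneg V -> nonneg (opP V).
Proof.
move=> V0 [|m] //=; apply: mulr_ge0; first by rewrite invr_ge0 ltW// nat_subx_gt0.
by apply: sumr_ge0 => i _; rewrite V0.
Qed.

Lemma opQ_ge0 V : nonneg V -> nonneg (opQ V).
Proof. by move=> V0 m; rewrite divr_ge0. Qed.

Lemma pairing_term_ge0 V W m n : nonneg V -> nonneg W ->
  (0 <= (V m * conn m n * W n)%:E)%E.
Proof.
move=> V0 W0; rewrite lee_fin; apply: mulr_ge0 => //; apply: mulr_ge0 => //.
exact: conn_ge0.
Qed.

Lemma pairingC V W : nonneg V -> nonneg W -> pairing V W = pairing W V.
Proof.
move=> V0 W0; rewrite /pairing esum_swap; last first.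
  by move=> m n; exact: pairing_term_ge0.
apply: eq_esum => m _; apply: eq_esum => n _.
by rewrite connC; congr (_%:E); ring.
Qed.

(** The transport relation: summing the connector over the tail of [m] trades
    a factor [opP] on the left for a factor [opQ] on the right. *)
Lemma pairing_transport V W : nonneg V -> nonneg W -> W 0%N = 0 ->
  pairing (opP V) W = pairing V (opQ W).
Proof.
move=> V0 W0 W00; rewrite /pairing [LHS]esum_swap; last first.
  by move=> m n; apply: pairing_term_ge0 => //; exact: opP_ge0.
rewrite [RHS]esum_swap; last first.
  by move=> m n; apply: pairing_term_ge0 => //; exact: opQ_ge0.
apply: eq_esum => -[|n] _.
  by rewrite /opQ W00; apply: eq_esum => m _; rewrite mul0r !mulr0.
(* [opP V m] is written as a sum over all [i < m]; the factor [0 < m] takes care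
   of the value [0] of [opP V] at [0]. *)
pose c m := conn m n.+1 / (m%:R - x) * W n.+1.
have c0 m : 0 <= ((0 < m)%N%:R * c m).
  case: m => [|m]; first by rewrite mul0r.
  by rewrite mul1r /c mulr_ge0 ?W0// divr_ge0 ?conn_ge0// ltW// nat_subx_gt0.
transitivity (\esum_(m in [set: nat]) \esum_(i in [set: nat])
    (V i * (i < m)%N%:R * ((0 < m)%N%:R * c m))%:E)%R.
  apply: eq_esum => m _.
  under eq_esum => i _.
    rewrite mulrAC [V i * _]mulrC.
    over.
  rewrite esum_ltn; last by move=> i; rewrite mulr_ge0 ?V0.
  rewrite -mulr_sumr; case: m {c0} => [|m]; first by rewrite !mul0r.
  by rewrite /c mul1r; congr (_%:E); rewrite /opP; ring.
rewrite esum_swap; last first.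
  move=> m i; rewrite lee_fin; apply: mulr_ge0 => //.
  by apply: mulr_ge0 => //.
apply: eq_esum => i _.
transitivity (\esum_(m in [set: nat]) ((V i * W n.+1)%:E *
   ((i < m)%N%:R * (conn m n.+1 / (m%:R - x)))%:E)%E)%R.
  apply: eq_esum => -[|m] _; first by rewrite ltn0 !(mul0r, mulr0) mule0.
  by rewrite /c -EFinM; congr (_%:E); rewrite mul1r; ring.
rewrite esumZl ?mulr_ge0 ?V0 ?W0// => [|[|m]]; last 2 first.
- by rewrite ltn0 mul0r.
- by rewrite lee_fin mulr_ge0 ?ler0n// divr_ge0 ?conn_ge0// ltW// nat_subx_gt0.
by rewrite conn_tail -EFinM /opQ; congr (_%:E); ring.
Qed.

(** A new bottom box with exponent [k]. *)
Definition addbox (V : nat -> R) (k : nat) : nat -> R :=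
  iter k.-1 opQ (opP V).

Definition colfun (s : seq nat) : nat -> R := foldl addbox unit0 s.

Lemma iterP_ge0 a V : nonneg V -> nonneg (iter a opP V).
Proof. by move=> V0; elim: a => //= a IH; exact: opP_ge0. Qed.

Lemma iterQ_ge0 a V : nonneg V -> nonneg (iter a opQ V).
Proof. by move=> V0; elim: a => //= a IH; exact: opQ_ge0. Qed.

Lemma unit0_ge0 : nonneg unit0.
Proof. by move=> m; rewrite ler0n. Qed.

Lemma foldl_addbox_ge0 V s : nonneg V -> nonneg (foldl addbox V s).
Proof.
elim: s V => [//|k s IH] V V0; apply: IH; apply: iterQ_ge0; exact: opP_ge0.
Qed.

Lemma foldl_addbox_piece V a b : (0 < a)%N ->
  foldl addbox V (piece (a, b)) = iter b opQ (iter a opP V).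
Proof.
case: a => // a _; rewrite /piece -cats1 foldl_cat /= /addbox /=.
congr (iter b opQ (opP _)); elim: a V => [//|a IH] V /=; by rewrite IH -iterSr.
Qed.

(** The value at [0] stays [0] under [opQ], so the transport can be repeated. *)
Lemma pairing_iterP V W a : nonneg V -> nonneg W -> W 0%N = 0 ->
  pairing (iter a opP V) W = pairing V (iter a opQ W).
Proof.
move=> + W0 W00; elim: a V => [//|a IH] V V0.
rewrite iterSr IH ?pairing_transport//=; first exact: iterQ_ge0.
- by elim: {IH} a => //= a IHa; rewrite /opQ IHa mul0r.
- exact: opP_ge0.
Qed.

(** A piece, read as a string of operators, passes to the other side of the
    pairing as its dual. *)
Lemma pairing_piece V W a b : (0 < a)%N -> (0 < b)%N -> nonneg V -> nonneg W ->
  pairing (foldl addbox V (piece (a, b))) W =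
  pairing V (foldl addbox W (piece (b, a))).
Proof.
move=> a0 b0 V0 W0; rewrite !foldl_addbox_piece//.
(* The powers of [opQ] move first: the transport needs functions that vanish at
   [0], which is the case after an application of [opP]. *)
have PV0 := iterP_ge0 a V0; have PW0 := iterP_ge0 b W0.
rewrite pairingC//; last exact: iterQ_ge0.
rewrite -pairing_iterP//; last by case: a a0 {PV0}.
rewrite pairingC// pairing_iterP//; first by case: b b0 {PW0}.
Qed.

(** As the operators move one piece after another, their order is reversed, as in
    the definition of the dual index. *)
Lemma pairing_pieces V W ps : all is_piece ps -> nonneg V -> nonneg W ->
  pairing (foldl addbox V (flatten (map piece ps))) W =
  pairing V (foldl addbox W (flatten [seq piece (dual_piece p) | p <- rev ps])).
Proof.
elim: ps V => [//|[a b] ps IH] V /= /andP[/andP[/= a0 b0] hps] V0 W0.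
rewrite foldl_cat IH//; last exact: foldl_addbox_ge0.
rewrite pairing_piece//; last exact: foldl_addbox_ge0.
by rewrite rev_cons map_rcons flatten_rcons foldl_cat.
Qed.

(** The connector is [1] when one of its arguments is [0]. *)
Lemma pairing_unit0 V : nonneg V ->
  pairing V unit0 = (\esum_(m in [set: nat]) (V m)%:E)%R.
Proof.
move=> V0; apply: eq_esum => m _.
rewrite (eq_esum (b := fun n => (V m * conn m 0 * (n < 1)%N%:R)%:E)); last first.
  by move=> [|n] _; rewrite /unit0 // !mulr0.
rewrite (esum_ltn (a := fun=> V m * conn m 0)).
  by rewrite big_ord1 conn0 mulr1.
by move=> _; rewrite conn0 mulr1.
Qed.

(** Ohno's relation: all the operators pass from one side of the pairing with
    the empty column to the other. *)
Lemma esum_colfun_dual s : admissible s ->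
  (\esum_(m in [set: nat]) (colfun s m)%:E =
   \esum_(m in [set: nat]) (colfun (dual_index s) m)%:E)%R.
Proof.
move=> [ps [hps ->]]; have U0 := unit0_ge0.
rewrite -!pairing_unit0//; try exact: foldl_addbox_ge0.
rewrite pairing_pieces// pairingC//; last exact: foldl_addbox_ge0.
by rewrite /dual_index flatten_pieceK.
Qed.

(** A rational substitute for the square root: its increments are
    [growth m / (2 * (m + 1))], which makes sums of such terms telescope. *)
Definition growth (m : nat) : R := \prod_(i < m) (1 + (2 * i.+1%:R)^-1).

Lemma growthS m : growth m.+1 = growth m * (1 + (2 * m.+1%:R)^-1).
Proof. by rewrite /growth big_ord_recr. Qed.

Lemma growth_gt0 m : 0 < growth m.
Proof.
by apply: prodr_gt0 => i _; rewrite addr_gt0// invr_gt0 mulr_gt0.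
Qed.

Lemma iterQ_le V k m : nonneg V -> iter k opQ V m <= V m.
Proof.
move=> V0; elim: k => [//|k IH] /=; apply: le_trans IH; rewrite /opQ.
case: m => [|m]; first by rewrite invr0 mulr0 iterQ_ge0.
apply: ler_piMr; first exact: iterQ_ge0.
by rewrite invf_le1 ?ltr0n// ler1n.
Qed.

(** Since [x <= 1/2], the factor [1 / (m - x)] is at most [2 / m]. *)
Lemma opP_growth V c m : nonneg V ->
  (forall N, \sum_(i < N.+1) V i <= c * growth N) ->
  opP V m.+1 <= 2 * c * (growth m / m.+1%:R).
Proof.
move=> V0 hV; rewrite /opP.
have h1 : (m.+1%:R - x)^-1 <= 2 * m.+1%:R^-1.
  rewrite -[2]invrK -invfM lef_pV2 ?posrE ?nat_subx_gt0 ?mulr_gt0 ?ltr0n//.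
  have : (1 : R) <= m.+1%:R by rewrite ler1n.
  have := x12; lra.
have h2 : 0 <= (m.+1%:R - x)^-1 by rewrite invr_ge0 ltW// nat_subx_gt0.
apply: le_trans (ler_wpM2l h2 (hV m)) _.
have h3 : 0 <= c * growth m by apply: le_trans (hV m); apply: sumr_ge0.
apply: le_trans (ler_wpM2r h3 h1) _.
by rewrite le_eqVlt; apply/orP; left; apply/eqP; ring.
Qed.

Lemma sum_addbox_le (V h : nat -> R) k c N : nonneg V ->
  (forall m, addbox V k m.+1 <= c * (h m - h m.+1)) ->
  \sum_(i < N.+1) addbox V k i <= c * (h 0%N - h N).
Proof.
move=> V0 hV; elim: N => [|N IH].
  rewrite big_ord1 subrr mulr0 /addbox; apply: le_trans (iterQ_le _ _ _) _ => //.
  exact: opP_ge0.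
rewrite big_ord_recr /=; apply: le_trans (lerD IH (hV N)) _.
by rewrite -mulrDr addrA subrK.
Qed.

Lemma bound_ge0 V c : nonneg V ->
  (forall N, \sum_(i < N.+1) V i <= c * growth N) -> 0 <= c.
Proof.
move=> V0 /(_ 0%N); rewrite /growth big_ord0 mulr1; apply: le_trans.
exact: sumr_ge0.
Qed.

(** Partial sums of any column grow at most like [growth]: the next function is
    at most a multiple of the increments of [growth]. *)
Lemma addbox_growth V c k : nonneg V ->
  (forall N, \sum_(i < N.+1) V i <= c * growth N) ->
  forall N, \sum_(i < N.+1) addbox V k i <= 4 * c * growth N.
Proof.
move=> V0 hV N; have c0 := bound_ge0 V0 hV; elim: N => [|N IH].
  rewrite big_ord1 /addbox; apply: (@le_trans _ _ (opP V 0)).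
    by apply: iterQ_le; exact: opP_ge0.
  by rewrite /= mulr_ge0 ?mulr_ge0// ltW// growth_gt0.
rewrite big_ord_recr /= growthS.
have h : addbox V k N.+1 <= 2 * c * (growth N / N.+1%:R).
  by apply: le_trans (opP_growth _ V0 hV); apply: iterQ_le; exact: opP_ge0.
apply: le_trans (lerD IH h) _.
rewrite le_eqVlt; apply/orP; left; apply/eqP; field.
by rewrite addrC natr1 pnatr_eq0.
Qed.

Lemma colfun_growth s :
  exists c, forall N, \sum_(i < N.+1) colfun s i <= c * growth N.
Proof.
rewrite /colfun.
have [c hc] : exists c, forall N, \sum_(i < N.+1) unit0 i <= c * growth N.
  exists 1 => N; rewrite mul1r big_ord_recl /= big1 ?addr0//.
  elim: N => [|N IH]; first by rewrite /growth big_ord0.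
  rewrite growthS; apply: le_trans IH _; apply: ler_peMr.
    by rewrite ltW// growth_gt0.
  by rewrite lerDl invr_ge0 mulr_ge0.
elim: s unit0 unit0_ge0 c hc => [|k s IH] V V0 c hc /=; first by exists c.
apply: IH (addbox_growth k V0 hc).
by apply: iterQ_ge0; exact: opP_ge0.
Qed.

(** With a bottom exponent of at least [2] the new function is at most a multiple
    of the decrements of [growth m / (m + 1)], so its partial sums are bounded. *)
Lemma addbox_bounded V c k : (1 < k)%N -> nonneg V ->
  (forall N, \sum_(i < N.+1) V i <= c * growth N) ->
  forall N, \sum_(i < N.+1) addbox V k i <= 8 * c.
Proof.
move=> k1 V0 hV N; have c0 := bound_ge0 V0 hV.
(* The decrements of [h] are [growth m / (2 * (m + 1) * (m + 2))]; the constant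
   [8] absorbs the factor [2] of [opP_growth], this [2], and [m + 2 <= 2 (m + 1)]. *)
pose h m := growth m / m.+1%:R.
have h0 m : 0 <= h m by rewrite divr_ge0// ltW// growth_gt0.
apply: (@le_trans _ _ (8 * c * (h 0%N - h N))); last first.
  apply: ler_piMr; first by rewrite mulr_ge0.
  have -> : h 0%N = 1 by rewrite /h /growth big_ord0 divr1.
  by rewrite gerBl.
apply: sum_addbox_le => // m.
case: k k1 => [|[|k]]// _; rewrite /addbox /=; apply: (@le_trans _ _ (opP V m.+1 / m.+1%:R)).
  rewrite -iterS iterSr; apply: (iterQ_le _ _ (opQ_ge0 (opP_ge0 V0))).
have m0 : (0 : R) < m.+1%:R by rewrite ltr0n.
apply: (@le_trans _ _ (2 * c * (growth m / m.+1%:R) / m.+1%:R)).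
  by rewrite ler_pM2r ?invr_gt0//; exact: opP_growth.
rewrite /h growthS -[m.+2%:R]natr1; have g0 := growth_gt0 m.
have m1 : (1 : R) <= m.+1%:R by rewrite ler1n.
move: (growth m) (m.+1%:R : R) m0 m1 g0 => g u u0 u1 g0.
rewrite -subr_ge0.
have -> : 8 * c * (g / u - g * (1 + (2 * u)^-1) / (u + 1)) - 2 * c * (g / u) / u =
  2 * c * g * (u - 1) / (u ^+ 2 * (u + 1)).
  have u1' : u + 1 != 0 by rewrite gt_eqF// addr_gt0.
  have u0' : u != 0 by rewrite gt_eqF.
  by field; rewrite ?u1' ?u0'.
have [u0' g0'] := (ltW u0, ltW g0).
have u2 : 0 <= u - 1 by rewrite subr_ge0.
by apply: divr_ge0; rewrite !mulr_ge0// ?exprn_ge0// addr_ge0.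
Qed.

(** The boxes above the bottom one contribute the slow growth of [colfun_growth],
    which the bottom box turns into boundedness. The default value [2] covers the
    empty column. *)
Lemma series_colfun_cvg s : (forall k, k \in s -> (0 < k)%N) ->
  (last 2 s != 1)%N -> exists L : R, (series (colfun s) n @[n --> \oo] --> L)%classic.
Proof.
move=> s0 s1; suff [c hc] : exists c, forall N, \sum_(i < N.+1) colfun s i <= c.
  have : cvgn (series (colfun s)).
    apply: nondecreasing_is_cvgn.
      apply/nondecreasing_seqP => n; rewrite /series /= big_nat_recr//= lerDl.
      by apply: foldl_addbox_ge0; exact: unit0_ge0.
    exists c => _ [n _ <-]; rewrite /series /= big_mkord.
    apply: le_trans (hc n); rewrite big_ord_recr /= lerDl.
    by apply: foldl_addbox_ge0; exact: unit0_ge0.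
  by move=> h; exists (limn (series (colfun s))).
case/lastP: s s0 s1 => [_ _|s k s0].
  by exists 1 => N; rewrite big_ord_recl /= big1 ?addr0.
rewrite last_rcons => k1; have [c hc] := colfun_growth s.
have {}k1 : (1 < k)%N.
  by have := s0 k; rewrite mem_rcons mem_head => /(_ isT); case: k k1 {s0} => [|[]].
exists (8 * c) => N; rewrite /colfun foldl_rcons.
apply: addbox_bounded => //; apply: foldl_addbox_ge0; exact: unit0_ge0.
Qed.

End Column.

(** * A Jacobi-Trudi formula with weights depending on the content *)

Section Determinants.
Local Open Scope ring_scope.
Variables (R : comNzRingType) (w : nat).

(** The set [U] collects the rows in which the second summand is chosen. *)
Lemma det_addrows (A B : 'I_w -> 'I_w -> R) (c : 'I_w -> R) :
  \det (\matrix_(i, j) (A i j + c i * B i j)) =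
  \sum_(U : {set 'I_w}) \prod_(i in U) c i *
     \det (\matrix_(i, j) (if i \in U then B i j else A i j)).
Proof.
under [RHS]eq_bigr do rewrite mulr_sumr.
rewrite exchange_big /=; apply: eq_bigr => s _.
under eq_bigr do rewrite mxE addrC.
rewrite bigA_distr mulr_sumr; apply: eq_bigr => U _.
rewrite mulrCA; congr (_ * _).
rewrite [X in _ = X * _]big_mkcond -big_split /=; apply: eq_bigr => i _.
by rewrite mxE; case: ifP; rewrite ?mul1r.
Qed.

(** A block of zeros with [w - c] rows and [c + 1] columns is too large for a
    transversal to avoid it. *)
Lemma det_zero_block (A : 'M[R]_w) (c : 'I_w) :
  (forall i j : 'I_w, (c <= i)%N -> (j <= c)%N -> A i j = 0) -> \det A = 0.
Proof.
move=> A0; apply: big1 => s _.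
have [/existsP[i /andP[ci sic]]|] := boolP [exists i : 'I_w, (c <= i)%N && (s i <= c)%N].
  by rewrite (bigD1 i)//= A0// mul0r mulr0.
rewrite negb_exists => /forallP hs.
have : s @: [set i : 'I_w | (c <= i)%N]%SET \subset [set i : 'I_w | (c < i)%N]%SET.
  apply/fintype.subsetP => _ /imsetP[i + ->]; rewrite !inE => ci.
  by have := hs i; rewrite ci /= -ltnNge.
move=> /subset_leq_card; rewrite card_imset; last exact: perm_inj.
have -> : [set i : 'I_w | (c <= i)%N]%SET = c |: [set i : 'I_w | (c < i)%N]%SET.
  by apply/setP => i; rewrite !inE leq_eqVlt eq_sym.
by rewrite cardsU1 inE ltnn ltnn.
Qed.

Lemma perm_le_id (s : 'S_w) : (forall i, (s i <= i)%N) -> s = 1%g.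
Proof.
move=> hs; apply/permP => i; rewrite perm1.
have [n] := ubnP (val i); elim: n i => // n IH i /ltnSE hi.
apply: val_inj; apply/eqP; rewrite eqn_leq hs /= leqNgt; apply/negP => lt.
have := IH _ (leq_trans lt hi) => /perm_inj e.
by move: lt; rewrite e ltnn.
Qed.

End Determinants.

Section JacobiTrudi.
Local Open Scope classical_set_scope.
Local Open Scope ring_scope.
Variables (R : realType) (w : nat) (f : nat -> nat -> R).
Hypothesis f_ge0 : forall p m, 0 <= f p m.

(** The sum over one column that occupies the positions from [p] to [q - 1] and
    has entries at most [N]; [f p m] is the weight of an entry [m] at position
    [p]. *)
Fixpoint colsum (N p q : nat) : R :=
  if N is N'.+1 then
    colsum N' p q + (if q is q'.+1 then f q' N * colsum N' p q' else 0)
  else (p == q)%:R.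

Lemma colsum_lt N p q : (q < p)%N -> colsum N p q = 0.
Proof.
elim: N q => [|N IH] [|q] /= h; rewrite ?gtn_eqF// IH// ?addr0//.
by rewrite IH ?mulr0 ?addr0// ltnW.
Qed.

Lemma colsumS N p q :
  colsum N.+1 p q =
  colsum N p q + ((0 < q)%N%:R * f q.-1 N.+1) * colsum N p q.-1.
Proof. by case: q => [|q] /=; rewrite ?mul0r ?mul1r. Qed.

Implicit Types (sg et : 'I_w -> nat) (M : 'I_w -> nat -> nat).

Definition coldet N sg et : R := \det (\matrix_(i, j) colsum N (sg j) (et i)).

Definition decreasing (g : 'I_w -> nat) :=
  forall c c' : 'I_w, (c < c')%N -> (g c' < g c)%N.

Definition lower (et : 'I_w -> nat) (U : {set 'I_w}) (c : 'I_w) : nat :=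
  et c - (c \in U).

(** An entry [N + 1] of a column can only be at its bottom. Taken for all rows,
    [colsumS] expands the determinant over the sets [U] of columns that end with
    [N + 1]. *)
Lemma coldetS N sg et :
  coldet N.+1 sg et =
  \sum_(U : {set 'I_w})
     \prod_(c in U) ((0 < et c)%N%:R * f (et c).-1 N.+1) *
     coldet N sg (lower et U).
Proof.
rewrite /coldet.
have -> : \matrix_(i, j) colsum N.+1 (sg j) (et i) =
    \matrix_(i, j) (colsum N (sg j) (et i) +
      ((0 < et i)%N%:R * f (et i).-1 N.+1) * colsum N (sg j) (et i).-1)
    :> 'M[R]_w.
  by apply/matrixP => i j; rewrite !mxE colsumS.
rewrite det_addrows; apply: eq_bigr => U _; congr (_ * \det _).
by apply/matrixP => i j; rewrite !mxE /lower; case: ifP; rewrite ?subn0 ?subn1.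
Qed.

(** Fillings are extended by zero outside of the shape, whose boxes in column
    [c] sit at the positions from [sg c] to [et c - 1]. In these coordinates
    two boxes lie in the same row if column plus position is the same. *)
Definition ssyt sg et : set ('I_w -> nat -> nat) :=
  [set M | [/\ forall c p, (sg c <= p < et c)%N = (0 < M c p)%N,
     forall (c c' : 'I_w) p p', (c < c')%N -> (p + c = p' + c')%N ->
       (0 < M c p)%N -> (0 < M c' p')%N -> (M c p <= M c' p')%N &
     forall c p p', (p < p')%N -> (0 < M c p)%N -> (0 < M c p')%N ->
       (M c p < M c p')%N]].

Definition ssytN N sg et : set ('I_w -> nat -> nat) :=
  ssyt sg et `&` [set M | forall c p, (M c p <= N)%N].

Definition weight sg et M : R := \prod_c \prod_(sg c <= p < et c) f p (M c p).

Lemma weight_ge0 sg et M : 0 <= weight sg et M.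
Proof. by apply: prodr_ge0 => c _; apply: prodr_ge0. Qed.

Lemma decreasing_leq g (c c' : 'I_w) : decreasing g -> (c <= c')%N ->
  (g c' + (c' - c) <= g c)%N.
Proof.
move=> dg; have [n hn] := ubnP (c' - c)%N; elim: n c' hn => // n IH c' hn cc'.
move: cc'; rewrite leq_eqVlt => /orP[/eqP/val_inj->|cc'].
  by rewrite subnn addn0.
have h : (c'.-1 < w)%N by have := ltn_ord c'; lia.
have /= := IH (Ordinal h); have /= := dg (Ordinal h) c'.
have -> : (c'.-1 < c')%N by lia.
move=> /(_ isT) h1 h2; have h3 := h2 ltac:(lia) ltac:(lia).
by lia.
Qed.

(** A column of negative length gives a large block of zeros. *)
Lemma coldet_lt N sg et (c : 'I_w) : decreasing sg ->
  (forall i j : 'I_w, (i <= j)%N -> (et j <= et i)%N) ->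
  (et c < sg c)%N -> coldet N sg et = 0.
Proof.
move=> dsg het lt; apply: (@det_zero_block _ _ _ c) => i j ci jc.
rewrite mxE colsum_lt//.
have := het _ _ ci; have := decreasing_leq dsg jc; lia.
Qed.

Lemma coldet_eq N sg et (c c' : 'I_w) : c != c' -> et c = et c' ->
  coldet N sg et = 0.
Proof.
by move=> cc' e; apply: (determinant_alternate cc') => j; rewrite !mxE e.
Qed.

(** A transversal of nonzero entries matches the tops with the bottoms; both
    decrease and no bottom precedes its top, so the matching is the identity. *)
Lemma coldet0 sg et : decreasing sg -> decreasing et ->
  (forall c, (sg c <= et c)%N) ->
  coldet 0 sg et = [forall c, sg c == et c]%:R.
Proof.
move=> dsg dec_et le; have [/forallP h|/forallPn[c hc]] := boolP [forall c, sg c == et c].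
  rewrite /coldet.
  have -> : \matrix_(i, j) colsum 0 (sg j) (et i) = 1%:M :> 'M[R]_w; last first.
    by rewrite det1.
  apply/matrixP => i j; rewrite !mxE /= -(eqP (h i)).
  suff -> : (sg j == sg i) = (i == j) by [].
  apply/idP/idP => [/eqP e|/eqP->//].
  by apply/eqP; case: (ltngtP i j) => [/dsg|/dsg|/val_inj//]; rewrite e ltnn.
apply: big1 => s _.
have [/existsP[i hi]|] := boolP [exists i : 'I_w, sg (s i) != et i].
  by rewrite (bigD1 i)//= mxE /= (negPf hi) mul0r mulr0.
rewrite negb_exists => /forallP hs.
have s1 : s = 1%g.
  apply: perm_le_id => i; rewrite leqNgt; apply/negP => /dsg.
  have /negPn/eqP := hs i; have := le i; lia.
by have := hs c; rewrite s1 perm1 hc.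
Qed.

Implicit Type U : {set 'I_w}.

Definition cols_ending N sg et M : {set 'I_w} :=
  [set c : 'I_w | (sg c < et c)%N && (M c (et c).-1 == N)]%SET.

(** [remove] empties the boxes with the largest entry, and [adjoin] puts it back
    at the bottoms of the columns in [U]. *)
Definition remove N M : 'I_w -> nat -> nat :=
  fun c p => if M c p == N then 0%N else M c p.

Definition adjoin N et (U : {set 'I_w}) M : 'I_w -> nat -> nat :=
  fun c p => if (c \in U) && (p == (et c).-1) then N else M c p.

(** By strictness down the columns, the largest entry occurs at bottoms only. *)
Lemma cols_endingP N sg et M c p : ssytN N.+1 sg et M ->
  (M c p == N.+1) = (c \in cols_ending N.+1 sg et M) && (p == (et c).-1).
Proof.
move=> [[supp _ cols] bnd]; rewrite inE; apply/idP/idP => [/eqP e|]; last first.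
  by move=> /andP[/andP[_ h] /eqP->].
have := supp c p; rewrite e => /andP[h1 h2].
have -> : (sg c < et c)%N by lia.
suff pE : p = (et c).-1 by rewrite -pE e !eqxx.
apply/eqP; rewrite eqn_leq; apply/andP; split; first by lia.
rewrite leqNgt; apply/negP => lt.
have := cols c p (et c).-1 lt; rewrite e -supp => h.
have := h isT ltac:(lia); have := bnd c (et c).-1; lia.
Qed.

(** The removal of the bottoms of the columns in [U] leaves a skew shape. *)
Definition valid sg et (U : {set 'I_w}) :=
  (forall c, c \in U -> (sg c < et c)%N) /\ decreasing (lower et U).

(** Only adjacent columns with bottoms in the same row matter: if the left one
    ends with the largest entry, then so does the right one. *)
Lemma valid_cols_ending N sg et M : decreasing sg -> decreasing et ->
  ssytN N.+1 sg et M -> valid sg et (cols_ending N.+1 sg et M).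
Proof.
move=> dsg dec_et TM; have [[supp rows cols] bnd] := TM.
set U := cols_ending _ _ _ _; split => [c|c c' cc']; first by rewrite inE => /andP[].
rewrite /lower; have := decreasing_leq dec_et (ltnW cc').
have [cU|cU] := boolP (c \in U); last first.
  by have := dec_et _ _ cc'; case: (c' \in U); lia.
have [|adj] := boolP (et c' + 1 < et c)%N; first by case: (c' \in U); lia.
move=> h; have c'E : (c' = c.+1 :> nat)%N by lia.
have e : et c' = (et c).-1 by have := dec_et _ _ cc'; lia.
have lt : (sg c < et c)%N by move: cU; rewrite inE => /andP[].
have sgc := dsg _ _ cc'.
suff -> : c' \in U by lia.
have Mc : M c (et c).-1 = N.+1 by apply/eqP; rewrite (cols_endingP _ _ TM) cU eqxx.
have M'0 : (0 < M c' (et c').-1)%N by rewrite -supp; lia.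
rewrite inE eqn_leq bnd /=; apply/andP; split; first by lia.
rewrite -Mc; apply: rows => //; first by rewrite c'E; lia.
by rewrite Mc.
Qed.

Lemma remove_ssytN N sg et M : decreasing sg -> decreasing et ->
  ssytN N.+1 sg et M ->
  ssytN N sg (lower et (cols_ending N.+1 sg et M)) (remove N.+1 M).
Proof.
move=> dsg dec_et TM; have [[supp rows cols] bnd] := TM.
have rE c p : (0 < remove N.+1 M c p)%N -> remove N.+1 M c p = M c p.
  by rewrite /remove; case: ifP.
split; [split|] => /= [c p|c c' p p' cc' e h h'|c p p' pp' h h'|c p].
- rewrite /remove (cols_endingP _ _ TM) /lower; have := supp c p.
  have [cU|cU] /= := boolP (c \in _); last by rewrite subn0.
  have : (sg c < et c)%N by move: cU; rewrite inE => /andP[].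
  case: eqP => [->|/eqP ne] /= lt h; first by clear -lt; lia.
  by rewrite -h; congr (_ && _); clear -ne lt; lia.
- by move: (h) (h'); rewrite (rE _ _ h) (rE _ _ h'); exact: rows.
- by move: (h) (h'); rewrite (rE _ _ h) (rE _ _ h'); exact: cols.
rewrite /remove; case: eqP => // /eqP; have := bnd c p; lia.
Qed.

Lemma adjoin_ssytN N sg et U M : decreasing et -> valid sg et U ->
  ssytN N sg (lower et U) M -> ssytN N.+1 sg et (adjoin N.+1 et U M).
Proof.
move=> dec_et [vU dU] [[supp rows cols] bnd].
split; [split|] => /= [c p|c c' p p' cc' e|c p p' pp'|c p]; rewrite /adjoin.
- have := supp c p; rewrite /lower.
  have [cU|cU] /= := boolP (c \in U); last by rewrite subn0.
  have := vU _ cU.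
  case: eqP => [->|/eqP ne] /= lt h; first by clear -lt; lia.
  by rewrite -h; congr (_ && _); clear -ne lt; lia.
- case: ifP => [/andP[cU /eqP pE]|h]; case: ifP => // h'.
  - move=> _; rewrite -supp => /andP[_ lt]; have := decreasing_leq dU (ltnW cc').
    have e1 : lower et U c = (et c).-1 by rewrite /lower cU subn1.
    by move: lt; rewrite e1; have := vU _ cU; move: pE e cc'; clear; lia.
  - by move=> _ _; apply: leq_trans (bnd _ _) _.
  - exact: rows.
- case: ifP => [/andP[cU /eqP pE]|h].
    case: ifP => [/andP[_ /eqP]|_]; first by lia.
    by rewrite -supp /lower cU => _ /andP[_]; lia.
  case: ifP => [_ _ _|h' h1 h2]; first exact: leq_ltn_trans (bnd _ _) _.
  exact: cols.
by case: ifP => // _; apply: leq_trans (bnd _ _) _.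
Qed.

Lemma cols_ending_adjoin N sg et U M : valid sg et U ->
  ssytN N sg (lower et U) M -> cols_ending N.+1 sg et (adjoin N.+1 et U M) = U.
Proof.
move=> [vU _] [_ bnd]; apply/setP => c; rewrite inE /adjoin eqxx andbT.
have [/vU->|cU] := boolP (c \in U); first by rewrite eqxx.
by apply/negbTE; rewrite negb_and; have := bnd c (et c).-1; lia.
Qed.

Lemma removeK N sg et M : ssytN N.+1 sg et M ->
  adjoin N.+1 et (cols_ending N.+1 sg et M) (remove N.+1 M) = M.
Proof.
move=> TM; apply/funext => c; apply/funext => p.
rewrite /adjoin /remove -(cols_endingP _ _ TM).
by case: eqP.
Qed.

Lemma adjoinK N sg et U M : ssytN N sg (lower et U) M ->
  remove N.+1 (adjoin N.+1 et U M) = M.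
Proof.
move=> [[supp _ _] bnd]; apply/funext => c; apply/funext => p.
rewrite /remove /adjoin.
have [/andP[cU /eqP->]|_] := boolP ((c \in U) && (p == (et c).-1)); last first.
  by case: eqP => // e; have := bnd c p; rewrite e ltnn.
rewrite eqxx; have := supp c (et c).-1; rewrite /lower cU.
by case: (M c _) => // m /=; lia.
Qed.

Lemma weight_adjoin N sg et U M : (forall c, c \in U -> (sg c < et c)%N) ->
  weight sg et (adjoin N et U M) =
  \prod_(c in U) f (et c).-1 N * weight sg (lower et U) M.
Proof.
move=> vU; rewrite /weight [in RHS]big_mkcond -big_split /=.
apply: eq_bigr => c _; rewrite /lower /adjoin.
have [cU|cU] /= := boolP (c \in U); last by rewrite mul1r subn0.
have := vU _ cU; case: (et c) => // e lt.
rewrite big_nat_recr//= eqxx mulrC subn1 /=; congr (_ * _).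
by apply: eq_big_nat => p /andP[_ pe]; rewrite ltn_eqF.
Qed.

(** Removal of the largest entry is a bijection onto the tableaux of the smaller
    shape. *)
Lemma esum_cols_ending N sg et U : decreasing sg -> decreasing et -> valid sg et U ->
  (\esum_(M in ssytN N.+1 sg et `&` [set M | cols_ending N.+1 sg et M = U])
     (weight sg et M)%:E =
   (\prod_(c in U) f (et c).-1 N.+1)%:E *
   \esum_(M in ssytN N sg (lower et U)) (weight sg (lower et U) M)%:E)%E.
Proof.
move=> dsg dec_et vU; rewrite -esumZl; last 2 first.
- exact: prodr_ge0.
- by move=> M; rewrite lee_fin weight_ge0.
rewrite (reindex_esum (ssytN N sg (lower et U)) _ (adjoin N.+1 et U)).
  by apply: eq_esum => M _; rewrite -EFinM weight_adjoin//; case: vU.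
split.
- move=> M TM /=; split; [exact: adjoin_ssytN|exact: cols_ending_adjoin].
- move=> M M' /[!inE] TM TM' e.
  by rewrite -(@adjoinK N sg et U M)// e (@adjoinK N sg et).
move=> M [TM /= MU]; exists (remove N.+1 M).
  by rewrite -MU; exact: remove_ssytN.
by rewrite -MU; exact: removeK TM.
Qed.

(** A set [U] that does not leave a skew shape either shortens an empty column
    or moves two bottoms to the same position. *)
Lemma coldet_invalid N sg et U : decreasing sg -> decreasing et ->
  (forall c, (sg c <= et c)%N) -> ~ valid sg et U ->
  \prod_(c in U) ((0 < et c)%N%:R * f (et c).-1 N.+1) *
     coldet N sg (lower et U) = 0.
Proof.
move=> dsg dec_et le nv.
have mono (i j : 'I_w) : (i <= j)%N -> (lower et U j <= lower et U i)%N.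
  rewrite leq_eqVlt => /orP[/eqP/val_inj->//|/dec_et].
  by rewrite /lower; case: (i \in U); case: (j \in U); lia.
have [/existsP[c /andP[cU lt]]|] :=
    boolP [exists c : 'I_w, (c \in U) && (et c <= sg c)%N].
  have [e0|e0] := posnP (et c).
    by rewrite (bigD1 c)//= e0 ltnn !mul0r.
  rewrite (@coldet_lt _ _ _ c)// ?mulr0//.
  by rewrite /lower cU; lia.
rewrite negb_exists => /forallP hU; have hU' c : c \in U -> (sg c < et c)%N.
  by move=> cU; have := hU c; rewrite cU /= -ltnNge.
suff [c [c' [cc' e]]] : exists c c' : 'I_w, c != c' /\ lower et U c = lower et U c'.
  by rewrite (coldet_eq _ _ cc' e) mulr0.
apply/not_existsP => h; apply: nv; split => // c c' cc'.
rewrite ltn_neqAle mono ?(ltnW cc')// andbT; apply/negP => /eqP e.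
apply: (h c'); exists c; split => //; by rewrite -val_eqE /= gtn_eqF.
Qed.

(** Induction on [N]: both sides split over the set [U] of the columns that end
    with [N + 1], and invalid sets contribute [0] to both. *)
Lemma esum_ssytN N sg et : decreasing sg -> decreasing et ->
  (forall c, (sg c <= et c)%N) ->
  (\esum_(M in ssytN N sg et) (weight sg et M)%:E = (coldet N sg et)%:E)%E.
Proof.
move=> dsg; elim: N et => [|N IH] et dec_et le.
  rewrite coldet0//; have [/forallP h|/forallPn[c hc]] :=
      boolP [forall c, sg c == et c].
    have -> : ssytN 0 sg et = [set fun=> fun=> 0%N].
      apply/seteqP; split => [M [_ /= M0]|_ ->].
        by apply/funext => c; apply/funext => p; have := M0 c p; case: (M c p).
      split; [split|] => //= c p; rewrite (eqP (h c)); lia.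
    rewrite esum_set1 ?lee_fin ?weight_ge0// /weight big1// => c _.
    by rewrite (eqP (h c)) big_geq.
  rewrite (_ : ssytN 0 sg et = set0) ?esum_set0//.
  apply/seteqP; split => // M [[supp _ _] /= M0].
  have := supp c (sg c); have := le c; have := M0 c (sg c).
  by case: (M c (sg c)) => // _; rewrite leqnn ltn_neqAle hc => ->.
rewrite (esum_partition _ (cols_ending N.+1 sg et)); last first.
  by move=> M; rewrite lee_fin weight_ge0.
rewrite coldetS -sumEFin; apply: eq_bigr => U _.
have [vU|nvU] := pselect (valid sg et U); last first.
  rewrite coldet_invalid// esum1// => M [TM /= MU].
  by exfalso; apply: nvU; rewrite -MU; exact: valid_cols_ending.
rewrite esum_cols_ending// IH; last 2 first.
- by case: vU.
- move=> c; rewrite /lower; case: (boolP (c \in U)) => [cU|_].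
    by have := vU.1 _ cU; lia.
  by rewrite subn0.
rewrite -EFinM; congr ((_ * _)%:E); apply: eq_bigr => c cU.
by have := vU.1 _ cU; case: (et c) => // e _; rewrite mul1r.
Qed.

Lemma cvg_det (A : nat -> 'M[R]_w) (B : 'M[R]_w) :
  (forall i j, A n i j @[n --> \oo] --> B i j) ->
  \det (A n) @[n --> \oo] --> \det B.
Proof.
move=> AB; apply: cvg_big => [|s _]; first exact: add_continuous.
apply: cvgM; first exact: cvg_cst.
by apply: cvg_big => [|i _]; first exact: mul_continuous.
Qed.

Lemma ssyt_bounded sg et M : ssyt sg et M ->
  exists n, forall m, (n <= m)%N -> ssytN m sg et M.
Proof.
move=> TM; have [supp _ _] := TM.
exists (\max_(c < w) \max_(p < et c) M c p)%N => m hm; split => //= c p.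
have [->//|M0] := posnP (M c p); apply: leq_trans hm.
have pe : (p < et c)%N by move: M0; rewrite -supp => /andP[].
apply: leq_trans (leq_bigmax c).
exact: (leq_bigmax (Ordinal pe)).
Qed.

(** The Jacobi-Trudi formula, as the limit of [esum_ssytN]. *)
Lemma esum_ssyt sg et (L : 'I_w -> 'I_w -> R) :
  decreasing sg -> decreasing et -> (forall c, (sg c <= et c)%N) ->
  (forall i j, colsum N (sg j) (et i) @[N --> \oo] --> L i j) ->
  (\esum_(M in ssyt sg et) (weight sg et M)%:E =
   (\det (\matrix_(i, j) L i j))%:E)%E.
Proof.
move=> dsg dec_et le hL.
apply: (@esum_exhaust _ _ (fun N => ssytN N sg et) _ _ (fun N => coldet N sg et)).
- by move=> M; rewrite lee_fin weight_ge0.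
- by move=> N M [].
- exact: ssyt_bounded.
- by move=> N; exact: esum_ssytN.
apply: cvg_det => i j; rewrite mxE.
by under eq_fun do rewrite mxE; exact: hL.
Qed.

End JacobiTrudi.

Section ColumnSums.
Local Open Scope classical_set_scope.
Local Open Scope ring_scope.
Variables (R : realType) (x : R) (a : nat -> nat).

(** For [m > 0] this is the sum over [e] of [x ^ e * m ^ - (k + e)]. The value at
    [m = 0] is set to [0] because the general formula is negative there. *)
Definition boxwt (k m : nat) : R :=
  if m is 0 then 0 else (m%:R - x)^-1 / m%:R ^+ k.-1.

Definition slice (p q : nat) : seq nat := [seq a i | i <- iota p (q - p)].

Lemma slice_rcons p q : (p <= q)%N -> slice p q.+1 = rcons (slice p q) (a q).
Proof.
by move=> h; rewrite /slice subSn// -addn1 iotaD map_cat cats1 subnKC.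
Qed.

Lemma addboxS (V : nat -> R) k m :
  addbox x V k m.+1 = boxwt k m.+1 * \sum_(i < m.+1) V i.
Proof.
rewrite /addbox /boxwt; elim: k.-1 => [|n IH] /=; first by rewrite divr1.
by rewrite /opQ IH exprSr invfM; ring.
Qed.

Lemma addbox0 (V : nat -> R) k : addbox x V k 0 = 0.
Proof.
by rewrite /addbox; elim: k.-1 => //= n IH; rewrite /opQ IH mul0r.
Qed.

(** Both sides count the strictly increasing fillings of a column, sorted by
    their bottom entry on the right. *)
Lemma colsum_colfun N p q : (p <= q)%N ->
  colsum (fun i => boxwt (a i)) N p q =
  \sum_(i < N.+1) colfun x (slice p q) i.
Proof.
elim: N q => [|N IH] q /=.
  rewrite leq_eqVlt big_ord1 => /orP[/eqP->|pq].
    by rewrite /slice subnn eqxx.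
  rewrite ltn_eqF//; case: q pq => // q pq.
  by rewrite slice_rcons// /colfun foldl_rcons addbox0.
move=> pq; rewrite IH// [RHS]big_ord_recr /=; congr (_ + _).
move: pq; rewrite leq_eqVlt => /orP[/eqP<-|].
  rewrite /slice subnn /=; case: {IH}p => // p.
  by rewrite colsum_lt// mulr0.
by case: q => // q pq; rewrite IH// slice_rcons// /colfun foldl_rcons addboxS.
Qed.

End ColumnSums.

(** * Generating functions of Ohno sums *)

Section GeneratingFunction.
Local Open Scope classical_set_scope.
Local Open Scope ring_scope.
Variables (R : realType) (x : R) (D : {fset nat * nat}) (k : {ffun D -> nat}).
Hypotheses (x0 : 0 <= x) (x12 : x <= 2^-1) (k_gt0 : forall b, (0 < k b)%N).

Definition natfun n (e : {ffun D -> 'I_n}) : {ffun D -> nat} :=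
  [ffun b => nat_of_ord (e b)].

Lemma natfun_inj n : injective (@natfun n).
Proof.
move=> e e' ee; apply/ffunP => b; apply: val_inj.
by have := congr1 (fun g : {ffun D -> nat} => g b) ee; rewrite !ffunE.
Qed.

(** Bounded fillings form a finite type, over which sums are finite. *)
Lemma esum_natfun n (S : set {ffun D -> nat}) (P : pred {ffun D -> 'I_n})
    (H : {ffun D -> nat} -> \bar R) :
  (forall e, (0 <= H e)%E) ->
  (forall e, S e -> forall b, (e b < n)%N) -> (forall e, S (natfun e) <-> P e) ->
  \esum_(e in S) H e = (\sum_(e | P e) H (natfun e))%E.
Proof.
move=> H0 Sn SP; rewrite -esum_finType//.
apply: reindex_esum; split => [e /= /SP//|e e' _ _|e Se]; first exact: natfun_inj.
have hn := Sn _ Se; exists [ffun b => Ordinal (hn b)].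
  by apply/SP; rewrite (_ : natfun _ = e)//; apply/ffunP => b; rewrite !ffunE.
by apply/ffunP => b; rewrite !ffunE.
Qed.

Definition term (M e : {ffun D -> nat}) : R :=
  \prod_(b : D) (x ^+ e b * (M b)%:R ^- (k b + e b)).

Lemma term_ge0 M e : 0 <= term M e.
Proof.
by apply: prodr_ge0 => b _; rewrite mulr_ge0 ?invr_ge0 ?exprn_ge0// ler0n.
Qed.

Lemma Osum_term l :
  ((x ^+ l)%:E * Osum R k l)%E =
  \esum_(e in [set e : {ffun D -> nat} | (\sum_(b : D) e b)%N = l])
     \esum_(M in @SSYT D) (term M e)%:E.
Proof.
rewrite (@esum_natfun l.+1 _ (fun e => (\sum_(b : D) e b == l)%N)); last 3 first.
- by move=> e; apply: esum_ge0 => M _; rewrite lee_fin term_ge0.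
- by move=> e <- b; rewrite ltnS (bigD1 b)//= leq_addr.
- move=> e /=; have -> : (\sum_(b : D) natfun e b = \sum_(b : D) e b)%N.
    by apply: eq_bigr => b _; rewrite ffunE.
  by split=> [->//|/eqP].
rewrite /Osum ge0_sume_distrr; last first.
  move=> e _; apply: esum_ge0 => M _; rewrite lee_fin.
  by apply: prodr_ge0 => b _; rewrite invr_ge0 exprn_ge0// ler0n.
apply: eq_bigr => e /eqP el; rewrite /zeta -esumZl ?exprn_ge0//; last first.
  move=> M; rewrite lee_fin.
  by apply: prodr_ge0 => b _; rewrite invr_ge0 exprn_ge0// ler0n.
apply: eq_esum => M _; rewrite -EFinM; congr (_%:E).
rewrite -{1}el -prodrXr -big_split; apply: eq_bigr => b _ /=.
by rewrite !ffunE.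
Qed.

(** The product of the geometric series of all boxes, expanded. *)
Lemma esum_term (M : {ffun D -> nat}) : (forall b, (0 < M b)%N) ->
  \esum_(e in [set: {ffun D -> nat}]) (term M e)%:E =
  (\prod_(b : D) boxwt x (k b) (M b))%:E.
Proof.
move=> M0.
apply: (@esum_exhaust _ _ (fun n => [set e : {ffun D -> nat} | forall b, (e b < n)%N]) _ _
  (fun n => \prod_(b : D) series (geometric ((M b)%:R ^- k b) (x / (M b)%:R)) n)).
- by move=> e; rewrite lee_fin term_ge0.
- by [].
- move=> e _; exists (\sum_(b : D) e b).+1 => m hm b.
  by apply: leq_trans hm; rewrite ltnS (bigD1 b)//= leq_addr.
- move=> n; rewrite (@esum_natfun n _ predT).
  + rewrite sumEFin; congr (_%:E).
    under [RHS]eq_bigr do rewrite /series /= big_mkord.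
    rewrite bigA_distr_bigA /=; apply: eq_bigr => e _; apply: eq_bigr => b _.
    by rewrite ffunE exprD invfM exprMn exprVn; ring.
  + by move=> e; rewrite lee_fin term_ge0.
  + by [].
  + by move=> e; split => // _ b; rewrite ffunE ltn_ord.
apply: cvg_big => [|b _]; first exact: mul_continuous.
have m1 : (1 : R) <= (M b)%:R by rewrite ler1n.
have mx : x < (M b)%:R by have := x12; lra.
have -> : boxwt x (k b) (M b) = (M b)%:R ^- k b / (1 - x / (M b)%:R).
  rewrite /boxwt; have := M0 b; have := k_gt0 b; case: (k b) => // n _.
  case: (M b) m1 mx => // m m1 mx _ /=.
  rewrite exprS invfM; field.
  rewrite addrC natr1 pnatr_eq0 expf_neq0 ?pnatr_eq0//= andbT.
  by rewrite gt_eqF// subr_gt0.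
apply: cvg_geometric_series; rewrite ger0_norm ?divr_ge0//.
by rewrite ltr_pdivrMr ?mul1r// (lt_le_trans _ m1).
Qed.

(** The sum over [l] removes the condition on the weight of the increments,
    which can then be summed box by box. *)
Lemma esum_Osum :
  \esum_(l in [set: nat]) ((x ^+ l)%:E * Osum R k l)%E =
  \esum_(M in @SSYT D) (\prod_(b : D) boxwt x (k b) (M b))%:E.
Proof.
under eq_esum do rewrite Osum_term.
rewrite -(esum_bigcupT
  (fun l => [set e : {ffun D -> nat} | (\sum_(b : D) e b)%N = l])); last 2 first.
- by move=> i j _ _ [e [/= <- <-]].
- by move=> e; apply: esum_ge0 => M _; rewrite lee_fin term_ge0.
rewrite (_ : \bigcup_(l in _) _ = [set: {ffun D -> nat}]); last first.
  by apply/seteqP; split => // e _; exists (\sum_(b : D) e b)%N.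
rewrite esum_swap => [|e M]; last by rewrite lee_fin term_ge0.
by apply: eq_esum => M [M0 _ _]; exact: esum_term.
Qed.

End GeneratingFunction.

Section Positions.
Local Open Scope classical_set_scope.
Local Open Scope ring_scope.
Variables (R : realType) (D : {fset nat * nat}) (w : nat) (top bot : nat -> nat).
Hypothesis mem_D : forall r c,
  ((r, c) \in D) = (c < w)%N && (top c <= r < bot c)%N.

(** The position of a box in row [r] and column [c] is [r + shift c]; it is
    constant along diagonals and increases down the columns. *)
Definition shift (c : nat) : nat := (w.-1 - c)%N.

Definition getbox (M : {ffun D -> nat}) (b : nat * nat) : nat :=
  if insub b is Some b' then M b' else 0%N.

Lemma getboxE M (b : D) : getbox M (val b) = M b.
Proof. by rewrite /getbox valK. Qed.

Lemma getbox_out M b : b \notin D -> getbox M b = 0%N.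
Proof. by move=> h; rewrite /getbox insubN. Qed.

Definition straighten (M : {ffun D -> nat}) : 'I_w -> nat -> nat :=
  fun c p => if (shift c <= p)%N then getbox M (p - shift c, c : nat)%N else 0%N.

Lemma straightenE M (c : 'I_w) r : straighten M c (r + shift c)%N = getbox M (r, c : nat).
Proof. by rewrite /straighten leq_addl addnK. Qed.

Lemma straighten_gt0 (M : {ffun D -> nat}) c p :
  (0 < straighten M c p)%N ->
  exists2 r, p = (r + shift c)%N & (r, c : nat) \in D.
Proof.
rewrite /straighten; case: ifP => // h H; exists (p - shift c)%N; first by rewrite subnK.
by apply/negPn/negP => /getbox_out E; rewrite E in H.
Qed.

Let sg (c : 'I_w) : nat := (top c + shift c)%N.
Let et (c : 'I_w) : nat := (bot c + shift c)%N.

Lemma straighten_inj : injective straighten.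
Proof.
move=> M M' e; apply/ffunP => -[[r c] hb].
have := hb; rewrite mem_D => /andP[cw _].
have := congr1 (fun g => g (Ordinal cw) (r + shift c)%N) e.
by rewrite !(straightenE _ (Ordinal cw)) -!getboxE.
Qed.

Lemma straighten_bij : set_bij (@SSYT D) (ssyt sg et) straighten.
Proof.
split.
- move=> M [M0 rows cols]; split => [c p|c c' p p' cc' e|c p p' pp'].
  + rewrite /straighten /sg /et; case: (leqP (shift c) p) => h; last by lia.
    have [hb|hb] := boolP ((p - shift c, c : nat)%N \in D).
      have := M0 [` hb]%fset; rewrite -getboxE /= => ->.
      by move: hb; rewrite mem_D; lia.
    rewrite getbox_out// ltnn; apply/negbTE; apply: contra hb.
    by rewrite mem_D ltn_ord; lia.
  + move=> h h'; have [r pE rD] := straighten_gt0 h.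
    have [r' pE' rD'] := straighten_gt0 h'.
    rewrite pE pE' !straightenE (getboxE M [` rD]%fset) (getboxE M [` rD']%fset).
    apply: rows => //=.
    by move: e; rewrite pE pE' /shift; have := ltn_ord c'; lia.
  + move=> h h'; have [r pE rD] := straighten_gt0 h.
    have [r' pE' rD'] := straighten_gt0 h'.
    rewrite pE pE' !straightenE (getboxE M [` rD]%fset) (getboxE M [` rD']%fset).
    by apply: cols => //=; lia.
- by move=> M M' _ _; exact: straighten_inj.
move=> N [supp rows cols].
pose M : {ffun D -> nat} := [ffun b : D =>
  if insub (val b).2 is Some c then N c ((val b).1 + shift (val b).2)%N else 0%N].
have ME r (c : 'I_w) (h : (r, c : nat) \in D) : M [` h]%fset = N c (r + shift c)%N.
  by rewrite ffunE /= valK.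
have N0 r (c : 'I_w) : (r, c : nat) \in D -> (0 < N c (r + shift c))%N.
  by rewrite mem_D -supp /sg /et; lia.
exists M; last first.
  apply/funext => c; apply/funext => p; rewrite /straighten.
  case: (leqP (shift c) p) => h; last first.
    by have := supp c p; case: (N c p) => // n; rewrite /sg; lia.
  have [hb|hb] := boolP ((p - shift c, c : nat)%N \in D).
    by rewrite (getboxE M [` hb]%fset) ME subnK.
  rewrite getbox_out//; have := supp c p; case: (N c p) => // n.
  by move: hb; rewrite mem_D ltn_ord /sg /et; lia.
split.
- move=> [[r c] hb]; have := hb; rewrite mem_D => /andP[cw _].
  by rewrite (ME _ (Ordinal cw)); apply: (N0 _ (Ordinal cw)).
- move=> [[r c] hb] [[r' c'] hb'] /= rr cc; rewrite -{}rr in hb' *.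
  have := hb; have := hb'; rewrite !mem_D => /andP[cw' _] /andP[cw _].
  rewrite (ME _ (Ordinal cw)) (ME _ (Ordinal cw')).
  apply: rows => //=; first by rewrite /shift; lia.
  + exact: (N0 _ (Ordinal cw)).
  + exact: (N0 _ (Ordinal cw')).
move=> [[r c] hb] [[r' c'] hb'] /= cc rr; rewrite -{}cc in hb' *.
have := hb; rewrite !mem_D => /andP[cw _].
rewrite !(ME _ (Ordinal cw)); apply: cols; first by rewrite ltn_add2r.
  exact: (N0 _ (Ordinal cw)).
exact: (N0 _ (Ordinal cw)).
Qed.

Lemma prod_boxes (G : nat * nat -> R) :
  \prod_(b : D) G (val b) = \prod_(c < w) \prod_(top c <= r < bot c) G (r, c : nat).
Proof.
rewrite -(big_seq_fsetE _ D xpredT G) /=.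
have -> : \prod_(i <- D) G i =
    \prod_(i <- [seq (r, c) | c <- iota 0 w, r <- index_iota (top c) (bot c)]) G i.
  apply: perm_big; apply: uniq_perm; first exact: fset_uniq.
    apply: allpairs_uniq_dep => [|c _|]; rewrite ?iota_uniq//.
    by move=> [c r] [c' r'] _ _ [-> ->].
  move=> [r c]; rewrite mem_D; apply/idP/allpairsPdep => [h|].
    have [cw tb] := andP h.
    by exists c, r; split; [rewrite mem_iota|rewrite mem_index_iota|].
  by move=> [c' [r' [+ + [-> ->]]]]; rewrite mem_iota mem_index_iota => /= -> ->.
have -> : iota 0 w = index_iota 0 w by rewrite /index_iota subn0.
by rewrite big_allpairs_dep big_mkord.
Qed.

Variables (wt : nat -> nat -> R) (k : {ffun D -> nat}) (a : nat -> nat).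
Hypothesis k_pos : forall b : D, k b = a ((val b).1 + shift (val b).2)%N.

Lemma prod_weight (M : {ffun D -> nat}) :
  \prod_(b : D) wt (k b) (M b) = weight (fun p => wt (a p)) sg et (straighten M).
Proof.
pose G b := wt (a (b.1 + shift b.2)%N) (getbox M b).
transitivity (\prod_(b : D) G (val b)).
  by apply: eq_bigr => b _; rewrite k_pos /G getboxE.
rewrite prod_boxes /weight; apply: eq_bigr => c _.
by rewrite /sg /et big_addn addnK; apply: eq_bigr => r _; rewrite straightenE.
Qed.

Lemma esum_straighten :
  \esum_(M in @SSYT D) (\prod_(b : D) wt (k b) (M b))%:E =
  \esum_(M in ssyt sg et) (weight (fun p => wt (a p)) sg et M)%:E.
Proof.
rewrite (reindex_esum _ _ _ _ straighten_bij).
by apply: eq_esum => M _; rewrite prod_weight.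
Qed.

End Positions.

Section Coefficients.
Local Open Scope classical_set_scope.
Local Open Scope ring_scope.
Variable R : realType.

(** Powers beyond [l] contribute [O(x ^ (l + 1))], which is negligible against
    [x ^ l] as [x] tends to [0]. *)
Lemma coef_le (a b : nat -> R) (L : R) l :
  (forall i, 0 <= a i) -> (forall i, 0 <= b i) ->
  (forall x, 0 <= x -> x <= 2^-1 ->
    \esum_(i in [set: nat]) (x ^+ i * a i)%:E =
    \esum_(i in [set: nat]) (x ^+ i * b i)%:E) ->
  \esum_(i in [set: nat]) (2^-1 ^+ i * a i)%:E = L%:E ->
  (forall i, (i < l)%N -> a i = b i) -> b l <= a l.
Proof.
move=> a0 b0 ab aL abl; apply/ler_addgt0Pr => e e0.
have L0 : 0 <= L.
  rewrite -lee_fin -aL; apply: esum_ge0 => i _.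
  by rewrite lee_fin mulr_ge0// exprn_ge0.
have K0 : 0 < 2 ^+ l.+1 * L + 1 by rewrite ltr_wpDl// mulr_ge0.
(* For [i > l], [x ^ i <= x ^ (l + 1) * 2 ^ (l + 1) * 2 ^ (- i)], so the tail at
   [x] is at most [x ^ (l + 1) * 2 ^ (l + 1) * L]; [x] makes this less than
   [e * x ^ l]. *)
pose x := Order.min 2^-1 (e / (2 ^+ l.+1 * L + 1)).
have x0 : 0 < x by rewrite lt_min invr_gt0 ltr0n divr_gt0.
have x12 : x <= 2^-1 by rewrite ge_min lexx.
have xe : x * (2 ^+ l.+1 * L) <= e.
  have : x <= e / (2 ^+ l.+1 * L + 1) by rewrite ge_min lexx orbT.
  rewrite ler_pdivlMr// mulrDr mulr1 => h; apply: le_trans h.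
  by rewrite lerDl ltW.
have xn i : 0 <= x ^+ i by rewrite exprn_ge0// ltW.
have lo : ((\sum_(i < l.+1) x ^+ i * b i)%:E <=
    \esum_(i in [set: nat]) (x ^+ i * b i)%:E)%E.
  rewrite -(@esum_ltn _ (fun i => x ^+ i * b i)) => [|i]; last exact: mulr_ge0.
  apply: le_esum => i _; rewrite lee_fin; apply: ler_piMr; first exact: mulr_ge0.
  by case: (i < _)%N.
have hi : (\esum_(i in [set: nat]) (x ^+ i * a i)%:E <=
    (\sum_(i < l.+1) x ^+ i * a i + x ^+ l.+1 * 2 ^+ l.+1 * L)%:E)%E.
  rewrite EFinD -(@esum_ltn _ (fun i => x ^+ i * a i)) => [|i]; last exact: mulr_ge0.
  rewrite EFinM -aL -esumZl; last 2 first.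
  - by rewrite mulr_ge0// exprn_ge0.
  - by move=> i; rewrite lee_fin mulr_ge0// exprn_ge0.
  rewrite -esumD; last 2 first.
  - by move=> i _; rewrite lee_fin; apply: mulr_ge0 => //; exact: mulr_ge0.
  - move=> i _; rewrite -EFinM lee_fin; apply: mulr_ge0; first by rewrite mulr_ge0// exprn_ge0.
    by rewrite mulr_ge0// exprn_ge0.
  apply: le_esum => i _; rewrite -EFinM -EFinD lee_fin.
  have c0 : 0 <= x ^+ l.+1 * 2 ^+ l.+1 * (2^-1 ^+ i * a i).
    by rewrite mulr_ge0// mulr_ge0// exprn_ge0.
  case: (ltnP i l.+1) => il; first by rewrite mulr1 lerDl.
  rewrite mulr0 add0r mulrA ler_wpM2r//.
  rewrite -(subnK il) addnC !exprD -mulrA ler_wpM2l//.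
  rewrite mulrA -exprMn divff// expr1n mul1r.
  by rewrite lerXn2r ?nnegrE// ltW.
have := le_trans lo (le_trans _ hi); rewrite -ab ?(ltW x0)//.
move=> /(_ (lexx _)); rewrite lee_fin !big_ord_recr /=.
rewrite (eq_bigr (fun i : 'I_l => x ^+ i * a i)); last first.
  by move=> i _; rewrite abl.
rewrite -addrA lerD2l exprS -[x * _ * _]mulrA mulrCA -[X in _ + X]mulrA -mulrDr.
rewrite ler_pM2l ?exprn_gt0// => /le_trans; apply.
by rewrite lerD2l -mulrA.
Qed.

(** Finiteness at [x = 1/2] makes all coefficients finite; then they are compared
    by induction. *)
Lemma coef_eq (A B : nat -> \bar R) :
  (forall i, (0 <= A i)%E) -> (forall i, (0 <= B i)%E) ->
  (forall x : R, 0 <= x -> x <= 2^-1 -> exists L : R,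
    \esum_(i in [set: nat]) ((x ^+ i)%:E * A i)%E = L%:E /\
    \esum_(i in [set: nat]) ((x ^+ i)%:E * B i)%E = L%:E) ->
  forall l, A l = B l.
Proof.
move=> A0 B0 AB.
have fin (C : nat -> \bar R) L : (forall i, (0 <= C i)%E) ->
    \esum_(i in [set: nat]) ((2^-1 ^+ i)%:E * C i)%E = L%:E ->
    forall i, C i \is a fin_num.
  move=> C0 CL i; rewrite ge0_fin_numE// ltNge leye_eq; apply/eqP => Ci.
  have : (+oo <= L%:E)%E.
    rewrite -CL; apply: esum_ge; exists [set i].
      by split; [exact: finite_set1|].
    by rewrite fsbig_set1 Ci gt0_muley// lte_fin exprn_gt0.
  by rewrite leye_eq.
have h0 : 0 <= 2^-1 :> R by [].
have [L [AL BL]] := AB _ h0 (lexx _).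
have fA := fin _ _ A0 AL; have fB := fin _ _ B0 BL.
pose a i := fine (A i); pose b i := fine (B i).
have aE i : A i = (a i)%:E by rewrite /a fineK.
have bE i : B i = (b i)%:E by rewrite /b fineK.
have a0 i : 0 <= a i by rewrite fine_ge0.
have b0 i : 0 <= b i by rewrite fine_ge0.
have gA x : \esum_(i in [set: nat]) (x ^+ i * a i)%:E =
    \esum_(i in [set: nat]) ((x ^+ i)%:E * A i)%E.
  by apply: eq_esum => i _; rewrite aE EFinM.
have gB x : \esum_(i in [set: nat]) (x ^+ i * b i)%:E =
    \esum_(i in [set: nat]) ((x ^+ i)%:E * B i)%E.
  by apply: eq_esum => i _; rewrite bE EFinM.
have ab x : 0 <= x -> x <= 2^-1 ->
    \esum_(i in [set: nat]) (x ^+ i * a i)%:E =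
    \esum_(i in [set: nat]) (x ^+ i * b i)%:E.
  by move=> x0 x12; rewrite gA gB; have [? [-> ->]] := AB _ x0 x12.
move=> l; rewrite aE bE; congr (_%:E).
have [n] := ubnP l; elim: n l => // n IH l ln.
apply/eqP; rewrite eq_le; apply/andP; split.
  apply: (@coef_le b a L) => // [x x0 x12||i il]; first by rewrite ab.
    by rewrite gB.
  by rewrite IH//; lia.
apply: (@coef_le a b L) => // [|i il]; first by rewrite gA.
by rewrite IH//; lia.
Qed.

End Coefficients.

(** * Comparison of two Jacobi-Trudi matrices *)

Section Transposition.
Local Open Scope classical_set_scope.
Local Open Scope ring_scope.
Variable R : realType.

Lemma esum_Osum_det (x : R) (D : {fset nat * nat}) (k : {ffun D -> nat})
    (w : nat) (top bot a : nat -> nat) (L : 'I_w -> 'I_w -> R) :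
  0 <= x -> x <= 2^-1 ->
  (forall r c, ((r, c) \in D) = (c < w)%N && (top c <= r < bot c)%N) ->
  (forall b : D, k b = a ((val b).1 + shift w (val b).2)%N) ->
  (forall b, (0 < k b)%N) ->
  let sg (c : 'I_w) := (top c + shift w c)%N in
  let et (c : 'I_w) := (bot c + shift w c)%N in
  decreasing sg -> decreasing et -> (forall c, (sg c <= et c)%N) ->
  (forall i j, colsum (fun p => boxwt x (a p)) N (sg j) (et i) @[N --> \oo] --> L i j) ->
  \esum_(l in [set: nat]) ((x ^+ l)%:E * Osum R k l)%E =
  (\det (\matrix_(i, j) L i j))%:E.
Proof.
move=> x0 x12 mem_D k_pos k_gt0 sg et dsg dec_et le hL.
rewrite esum_Osum// (esum_straighten mem_D _ k_pos); apply: esum_ssyt => //.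
move=> p [//|m]; rewrite /boxwt mulr_ge0// invr_ge0 ?exprn_ge0//.
by rewrite ltW// nat_subx_gt0.
Qed.

Lemma admissible_pos s : admissible s ->
  (forall m, m \in s -> (0 < m)%N) /\ (last 2 s != 1)%N.
Proof.
move=> [ps [+ ->]]; elim/last_ind: ps => [//|ps p IH].
rewrite all_rcons => /andP[/andP[_ p2] /IH[IH1 _]].
rewrite map_rcons flatten_rcons; split => [m|].
  rewrite mem_cat => /orP[/IH1//|].
  by rewrite mem_rcons inE => /orP[/eqP->//|]; rewrite mem_nseq => /andP[_ /eqP->].
by rewrite last_cat last_rcons eqSS -lt0n.
Qed.

Lemma admissible_dual_index s : admissible s -> admissible (dual_index s).
Proof.
move=> [ps [hps ->]]; exists (map dual_piece (rev ps)); split.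
  rewrite all_map all_rev; apply: sub_all hps => p.
  by rewrite /is_piece /= andbC.
by rewrite /dual_index flatten_pieceK// -map_comp.
Qed.

(** Bounding the entries by [N] gives the partial sums of the series of
    [colfun]. *)
Lemma colsum_cvg (x : R) (a : nat -> nat) p q : 0 <= x -> x <= 2^-1 ->
  admissible (slice a p q) -> (p <= q)%N ->
  colsum (fun p => boxwt x (a p)) N p q @[N --> \oo] -->
  fine (\esum_(m in [set: nat]) (colfun x (slice a p q) m)%:E).
Proof.
move=> x0 x12 adm pq; have [pos last1] := admissible_pos adm.
have [L hL] := series_colfun_cvg x12 pos last1.
rewrite (esum_nat (L := L))//; last first.
  by move=> m; apply: (foldl_addbox_ge0 x12); exact: unit0_ge0.
under eq_fun do rewrite colsum_colfun// -(big_mkord xpredT).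
by rewrite -(cvg_shiftS (series _)) in hL.
Qed.

(** If the columns of two tableaux, cut at all pairs of a top and a bottom, are
    dual to each other, then the two Jacobi-Trudi matrices are related by
    reflection in the antidiagonal and have the same determinant. *)
Lemma Osum_dual_positions (D D' : {fset nat * nat}) (k : {ffun D -> nat})
    (k' : {ffun D' -> nat}) (w : nat) (top bot a top' bot' a' : nat -> nat) :
  (forall r c, ((r, c) \in D) = (c < w)%N && (top c <= r < bot c)%N) ->
  (forall r c, ((r, c) \in D') = (c < w)%N && (top' c <= r < bot' c)%N) ->
  (forall b : D, k b = a ((val b).1 + shift w (val b).2)%N) ->
  (forall b : D', k' b = a' ((val b).1 + shift w (val b).2)%N) ->
  let sg (c : 'I_w) := (top c + shift w c)%N in
  let et (c : 'I_w) := (bot c + shift w c)%N in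
  let sg' (c : 'I_w) := (top' c + shift w c)%N in
  let et' (c : 'I_w) := (bot' c + shift w c)%N in
  decreasing sg -> decreasing et -> decreasing sg' -> decreasing et' ->
  (forall c, (sg c <= et c)%N) ->
  (forall i j, (sg j <= et i)%N = (sg' (rev_ord i) <= et' (rev_ord j))%N) ->
  (forall i j, (sg j <= et i)%N -> admissible (slice a (sg j) (et i)) /\
     slice a' (sg' (rev_ord i)) (et' (rev_ord j)) =
     dual_index (slice a (sg j) (et i))) ->
  forall l, Osum R k l = Osum R k' l.
Proof.
move=> mem_D mem_D' k_pos k_pos' sg et sg' et' dsg dec_et dsg' dec_et' le ord adm.
have le' c : (sg' c <= et' c)%N by rewrite -(rev_ordK c) -ord.
have adm' i j : (sg' j <= et' i)%N -> admissible (slice a' (sg' j) (et' i)).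
  rewrite -(rev_ordK i) -(rev_ordK j) -ord => h.
  have [h1 ->] := adm _ _ h; exact: admissible_dual_index.
have Osum_ge0 (E : {fset nat * nat}) (m : {ffun E -> nat}) l : (0 <= Osum R m l)%E.
  apply: sume_ge0 => e _; apply: esum_ge0 => M _; rewrite lee_fin.
  by apply: prodr_ge0 => b _; rewrite invr_ge0 exprn_ge0// ler0n.
have pos (E : {fset nat * nat}) (m : {ffun E -> nat}) (t b c : nat -> nat) :
    (forall r c, ((r, c) \in E) = (c < w)%N && (t c <= r < b c)%N) ->
    (forall b : E, m b = c ((val b).1 + shift w (val b).2)%N) ->
    (forall i : 'I_w, admissible (slice c (t i + shift w i) (b i + shift w i))) ->
    forall b, (0 < m b)%N.
  move=> mem_E m_pos hadm [[r i] hb]; rewrite m_pos /=.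
  have := hb; rewrite mem_E => /andP[iw tb].
  have [h _] := admissible_pos (hadm (Ordinal iw)).
  apply: h; apply: map_f; rewrite mem_iota /=; lia.
have k_gt0 : forall b, (0 < k b)%N.
  by apply: (pos _ _ _ _ _ mem_D k_pos) => i; have [] := adm i i (le i).
have k'_gt0 : forall b, (0 < k' b)%N.
  by apply: (pos _ _ _ _ _ mem_D' k_pos') => i; exact: adm'.
apply: coef_eq => // x x0 x12.
pose G s := fine (\esum_(m in [set: nat]) (colfun x s m)%:E)%R.
pose L i j := if (sg j <= et i)%N then G (slice a (sg j) (et i)) else 0.
pose L' i j := if (sg' j <= et' i)%N then G (slice a' (sg' j) (et' i)) else 0.
have LL' i j : L' i j = L (rev_ord j) (rev_ord i).
  rewrite /L' /L -(rev_ordK i) -(rev_ordK j) -ord !rev_ordK.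
  case: ifP => // h; have [h1 h2] := adm _ _ h.
  move: h2; rewrite !rev_ordK => ->; rewrite /G; congr fine.
  by rewrite [RHS](esum_colfun_dual x0 x12).
exists (\det (\matrix_(i, j) L i j)); split.
  apply: (esum_Osum_det x0 x12 mem_D k_pos) => // i j.
  rewrite /L; case: leqP => h; first by apply: colsum_cvg => //; have [] := adm _ _ h.
  by under eq_fun do rewrite colsum_lt//; exact: cvg_cst.
have -> : \det (\matrix_(i, j) L i j) = \det (\matrix_(i, j) L' i j).
  have -> : \matrix_(i, j) L' i j =
      row_perm (perm rev_ord_inj) (col_perm (perm rev_ord_inj) (\matrix_(i, j) L i j)^T).
    by apply/matrixP => i j; rewrite !mxE !permE LL'.
  rewrite row_permE col_permE !det_mulmx det_tr !det_perm odd_permV.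
  by rewrite mulrC -mulrA -signr_addb addbb expr0 mulr1.
apply: (esum_Osum_det x0 x12 mem_D' k_pos') => // i j.
rewrite /L'; case: leqP => h; first by apply: colsum_cvg => //; exact: adm'.
by under eq_fun do rewrite colsum_lt//; exact: cvg_cst.
Qed.

End Transposition.

(** * Concatenations of admissible pieces *)

Section Pieces.
Implicit Types s t : seq nat.

(** [n] ones have been read before [s]. *)
Lemma flatten_pieces_from n s : all (fun m => 0 < m) s -> last 2 s != 1 ->
  (s == [::] -> n = 0) ->
  flatten (map piece (pieces_from n.+1 s)) = nseq n 1 ++ s /\
  all is_piece (pieces_from n.+1 s).
Proof.
elim: s n => [|m s IH] n /=; first by move=> _ _ ->.
move=> /andP[m0 s0] last1 _; case: eqP => [m1|/eqP m1].
  have ns : s != [::] by case: s last1 {IH s0} => //=; rewrite m1.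
  have last1' : last 2 s != 1 by case: s ns last1 {IH s0}.
  have [|-> ->] := IH n.+1 s0 last1'; first by move/negPf: ns => ->.
  by split=> //; rewrite m1; elim: (n) => //= i ->.
have last1' : last 2 s != 1 by case: s last1 {IH s0}.
have [|h1 h2] := IH 0 s0 last1'; first by [].
rewrite /= h1 h2 andbT /piece /= -cats1 -catA /= /is_piece /=.
by case: m m0 m1 {last1} => [|[|m]].
Qed.

Lemma admissibleP s :
  admissible s <-> all (fun m => 0 < m) s && (last 2 s != 1).
Proof.
split => [/admissible_pos[h1 h2]|/andP[s0 last1]].
  by rewrite h2 andbT; apply/allP => m /h1.
have [|h1 h2] := @flatten_pieces_from 0 s s0 last1; first by [].
by exists (pieces s).
Qed.

Lemma pieces_from_cat n s t : s != [::] -> last 2 s != 1 ->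
  pieces_from n (s ++ t) = pieces_from n s ++ pieces t.
Proof.
elim: s n => [//|m [|m' s] IH] n _ /= last1; first by rewrite (negPf last1).
have IH' l := IH l isT last1; rewrite /= in IH'.
by case: (m == 1); rewrite !IH'.
Qed.

Lemma pieces_cat s t : last 2 s != 1 -> pieces (s ++ t) = pieces s ++ pieces t.
Proof. by case: s => // m s; exact: pieces_from_cat. Qed.

Lemma size_pieces s : size (pieces s) = count (fun m => m != 1) s.
Proof.
rewrite /pieces; elim: s {1}1 => [//|m s IH] n /=.
by case: eqP => _ /=; rewrite IH.
Qed.

Lemma dual_index_cat s t : last 2 s != 1 ->
  dual_index (s ++ t) = dual_index t ++ dual_index s.
Proof.
by move=> h; rewrite /dual_index pieces_cat// rev_cat map_cat flatten_cat.
Qed.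

Lemma size_dual_index s : admissible s ->
  size (dual_index s) = sumn [seq p.2 | p <- pieces s].
Proof.
move=> [ps [hps ->]]; rewrite /dual_index flatten_pieceK// size_flatten.
rewrite /shape -map_comp map_rev sumn_rev; congr sumn.
apply/eq_in_map => p /(allP hps)/andP[p1 p2].
by rewrite /= size_rcons size_nseq prednK.
Qed.

Lemma size_dual_index_gt0 s : admissible s -> s != [::] -> 0 < size (dual_index s).
Proof.
move=> [ps [hps ->]]; rewrite size_dual_index; last by exists ps.
rewrite flatten_pieceK//; case: ps hps => //= p ps /andP[/andP[_ p2] _] _.
by rewrite addn_gt0 p2.
Qed.

Lemma dual_index_piece a b : 0 < a -> 0 < b ->
  dual_index (piece (a, b)) = piece (b, a).
Proof.
move=> a0 b0; have -> : piece (a, b) = flatten (map piece [:: (a, b)]) by rewrite /= cats0.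
by rewrite /dual_index flatten_pieceK /= ?cats0// /is_piece /= a0 b0.
Qed.

End Pieces.

Section Slices.
Variable a : nat -> nat.

Lemma slice_nil p q : q <= p -> slice a p q = [::].
Proof. by rewrite /slice -subn_eq0 => /eqP->. Qed.

Lemma size_slice p q : size (slice a p q) = q - p.
Proof. by rewrite size_map size_iota. Qed.

Lemma slice_cat p q r : p <= q -> q <= r ->
  slice a p q ++ slice a q r = slice a p r.
Proof.
move=> pq qr; rewrite /slice -map_cat.
have -> : r - p = (q - p) + (r - q) by lia.
by rewrite iotaD subnKC.
Qed.

Lemma slice_nth (s t u : seq nat) (v : nat) : a =1 nth v (s ++ t ++ u) ->
  slice a (size s) (size s + size t) = t.
Proof.
move=> aE; apply: (@eq_from_nth _ v); rewrite size_slice ?addKn// => i it.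
rewrite /slice (nth_map 0) ?size_iota ?addKn// nth_iota// aE.
by rewrite !nth_cat ltnNge leq_addr /= addKn it.
Qed.

(** A piece may start at [q]. *)
Definition break q := (q == 0) || (a q.-1 != 1).

Lemma last_slice p q : break q -> last 2 (slice a p q) != 1.
Proof.
have [pq|pq] := ltnP p q; last by rewrite slice_nil.
by case: q pq => // q pq; rewrite slice_rcons// last_rcons.
Qed.

End Slices.

(** * The sequence of entries along the diagonals *)

Section DualGeometry.
Variables (k : tableau) (w : nat) (top bot : nat -> nat).
Hypothesis mem_k : forall r c,
  ((r, c) \in domf k) = (c < w) && (top c <= r < bot c).
Hypothesis top_mono : forall c c', c <= c' -> top c' <= top c.
Hypothesis bot_mono : forall c c', c <= c' -> bot c' <= bot c.
Hypothesis top_bot : forall c, top c <= bot c.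
Hypothesis kD : ID k.

Let sg c := top c + shift w c.
Let et c := bot c + shift w c.

Lemma shift_lt c c' : c < c' -> c' < w -> shift w c' < shift w c.
Proof. by rewrite /shift; lia. Qed.

Lemma sg_lt c c' : c < c' -> c' < w -> sg c' < sg c.
Proof.
move=> cc' c'w; have := shift_lt cc' c'w; have := top_mono (ltnW cc').
by rewrite /sg; lia.
Qed.

Lemma et_lt c c' : c < c' -> c' < w -> et c' < et c.
Proof.
move=> cc' c'w; have := shift_lt cc' c'w; have := bot_mono (ltnW cc').
by rewrite /et; lia.
Qed.

Lemma sg_le_et c : sg c <= et c.
Proof. by rewrite /sg /et leq_add2r. Qed.

Lemma column_rowsE c : c < w ->
  column_rows k c = iota (top c) (bot c - top c).
Proof.
move=> cw; apply: (sorted_eq leq_trans anti_leq).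
- exact: (sort_sorted leq_total).
- exact: (iota_sorted).
rewrite perm_sort; apply: uniq_perm; rewrite ?iota_uniq//.
  rewrite map_inj_in_uniq ?filter_uniq ?fset_uniq// => -[r1 c1] [r2 c2].
  by rewrite !mem_filter /= => /andP[/eqP-> _] /andP[/eqP-> _] ->.
move=> r; rewrite mem_iota subnKC//; apply/mapP/idP.
  by move=> [[r' c']]; rewrite mem_filter /= => /andP[/eqP->]; rewrite mem_k cw => ? ->.
by move=> h; exists (r, c); rewrite // mem_filter /= eqxx mem_k cw.
Qed.

Definition occupied p (c : 'I_w) : bool :=
  (shift w c <= p) && ((p - shift w c, nat_of_ord c) \in domf k).

(** The entry at position [p]. A gap between the positions of two columns that
    share no row is filled with [1, ..., 1, 2], a single admissible piece: its
    dual has length [1], which is the length of the corresponding gap in the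
    dual tableau. *)
Definition diagseq (p : nat) : nat :=
  if [pick c | occupied p c] is Some c then entry k (p - shift w c) c
  else if [exists c : 'I_w, sg c == p.+1] then 2 else 1.

Local Notation a := diagseq.

Lemma diagseqE r c : (r, c) \in domf k -> a (r + shift w c) = entry k r c.
Proof.
move=> h; have cw : c < w by move: h; rewrite mem_k => /andP[].
have [diag _ _] := kD; rewrite /a; case: pickP => [c' /andP[le h']|/(_ (Ordinal cw))].
  apply: diag => //; have := ltn_ord c'; move: le; rewrite /shift; lia.
by rewrite /occupied /= leq_addl addnK h.
Qed.

Lemma slice_column c : c < w -> column k c = slice a (sg c) (et c).
Proof.
move=> cw; rewrite /column column_rowsE// /slice.
have -> : et c - sg c = bot c - top c by rewrite /et /sg; lia.
rewrite /sg addnC iotaDl -map_comp; apply/eq_in_map => r.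
rewrite mem_iota subnKC// => h; rewrite /= addnC diagseqE//.
by rewrite mem_k cw.
Qed.

Lemma admissible_column c : admissible (column k c).
Proof. by have [_ + _] := kD. Qed.

Lemma diagseq_free p : (forall c, ~~ occupied p c) ->
  a p = if [exists c : 'I_w, sg c == p.+1] then 2 else 1.
Proof.
by move=> h; rewrite /a; case: pickP => // c hc; have := h c; rewrite hc.
Qed.

Lemma diagseq_gt0 p : 0 < a p.
Proof.
rewrite /a; case: pickP => [c /andP[le h]|_]; last by case: ifP.
have := h; rewrite mem_k => /andP[_ tb].
have /admissible_pos[pos _] := admissible_column c.
apply: pos; rewrite /column column_rowsE//; apply: map_f.
by rewrite mem_iota subnKC.
Qed.

(** Tops of columns start a piece: the box to the right of the top box of a
    column, which comes just before it, is not [1]. *)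
Lemma break_sg c : c < w -> break a (sg c).
Proof.
move=> cw; rewrite /break; have [//|sg0 /=] := posnP (sg c).
have pE : (sg c).-1.+1 = sg c by rewrite prednK.
have [h|h] := boolP ((top c, c.+1) \in domf k).
  have := h; rewrite mem_k => /andP[c1w /andP[_ tb]].
  have -> : (sg c).-1 = top c + shift w c.+1 by rewrite /sg /shift; lia.
  rewrite diagseqE//; apply/eqP; have [_ _ top1] := kD.
  apply: top1 => // [|r']; rewrite mem_k cw.
    by have := bot_mono (leqnSn c); lia.
  by move=> /= /andP[].
(* Otherwise the position before the top is free and carries the [2] of a gap. *)
rewrite diagseq_free => [|c'].
  by rewrite pE; case: existsP => // -[]; exists (Ordinal cw).
apply/negP => /andP[le]; rewrite mem_k ltn_ord /= => tb.
have [c'c|cc'] := leqP c' c.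
  have := top_mono c'c; move: tb le sg0; rewrite /sg /shift; lia.
have c1w : c.+1 < w by have := ltn_ord c'; lia.
have := bot_mono cc'; have := top_mono (leqnSn c); move: h; rewrite mem_k c1w /=.
by have := ltn_ord c'; move: tb le sg0; rewrite /sg /shift; lia.
Qed.

Lemma break_et c : c < w -> break a (et c).
Proof.
move=> cw; have := sg_le_et c; rewrite leq_eqVlt => /orP[/eqP<-|lt].
  exact: break_sg.
have /admissible_pos[_] := admissible_column c; rewrite slice_column//.
rewrite /break; case: (et c) lt => // e lt.
by rewrite slice_rcons// last_rcons.
Qed.

Lemma admissible_slice p q : break a q -> admissible (slice a p q).
Proof.
move=> h; apply/admissibleP; rewrite last_slice// andbT.
by apply/allP => m /mapP[i _ ->]; exact: diagseq_gt0.
Qed.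

(** * The layout of the dual tableau *)

(** Pieces are dualized in reverse order, so the dual of a segment ending at [q]
    starts, in the dual sequence, after the dual of everything from [q] on. *)
Definition dualpos q := size (dual_index (slice a q (et 0))).

Lemma dualpos_cat p q : break a q -> p <= q -> q <= et 0 ->
  dualpos p = dualpos q + size (dual_index (slice a p q)).
Proof.
move=> bq pq qe; rewrite /dualpos -(slice_cat _ pq qe) dual_index_cat ?size_cat//.
exact: last_slice.
Qed.

Lemma size_dual_slice_gt0 p q : break a q -> p < q ->
  0 < size (dual_index (slice a p q)).
Proof.
move=> bq pq; apply: size_dual_index_gt0; first exact: admissible_slice.
by rewrite -size_eq0 size_slice -lt0n subn_gt0.
Qed.

Lemma dualpos_lt p q : break a q -> p < q -> q <= et 0 -> dualpos q < dualpos p.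
Proof.
move=> bq pq qe; rewrite (dualpos_cat bq (ltnW pq) qe).
by have := size_dual_slice_gt0 bq pq; lia.
Qed.

Lemma et_le0 c : c < w -> et c <= et 0.
Proof. by case: c => // c cw; apply: ltnW; exact: et_lt. Qed.

Lemma sg_le0 c : c < w -> sg c <= et 0.
Proof. by move=> cw; apply: leq_trans (et_le0 cw); exact: sg_le_et. Qed.

Lemma dualpos_sg c : c < w ->
  dualpos (sg c) = dualpos (et c) + size (dual_column k c).
Proof.
move=> cw; rewrite (dualpos_cat (break_et cw) (sg_le_et c) (et_le0 cw)).
by rewrite /dual_column slice_column.
Qed.

Lemma all_ltn_iota i p n : all (ltn i) (iota p n) = (n == 0) || (i < p).
Proof.
case: n => // n; apply/allP/idP => [/(_ p)|lt m].
  by rewrite mem_iota leqnn addnS ltnS leq_addr => /(_ isT).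
by rewrite mem_iota => /andP[pm _]; exact: leq_trans pm.
Qed.

Lemma pieces_aboveE h : h.+1 < w ->
  pieces_above k h =
  count (fun i => (a (i + shift w h.+1) != 1) && ((top h == bot h) || (i < top h)))
    (iota (top h.+1) (bot h.+1 - top h.+1)).
Proof.
move=> hw; rewrite /pieces_above !column_rowsE//; last exact: ltnW.
apply: eq_in_count => i; rewrite mem_iota subnKC// => ti.
rewrite diagseqE; last by rewrite mem_k hw.
by rewrite all_ltn_iota subn_eq0 [top h == _]eqn_leq top_bot.
Qed.

(** When two adjacent columns share a row, exactly one of the pieces of the
    right column that end before the top of the left one is not above it: the
    one that ends beside the top box. *)
Lemma pieces_above_share h : h.+1 < w -> sg h <= et h.+1 ->
  (pieces_above k h).+1 = size (pieces (slice a (sg h.+1) (sg h))).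
Proof.
move=> hw share; have hw' := ltnW hw; rewrite pieces_aboveE// size_pieces.
have sh : shift w h = (shift w h.+1).+1 by rewrite /shift; lia.
have tb : top h < bot h.+1 by move: share; rewrite /sg /et sh; lia.
have lt := sg_lt (ltnSn h) hw.
have t1 := top_mono (leqnSn h).
have bh := bot_mono (leqnSn h).
have e : sg h = (top h + shift w h.+1).+1 by rewrite /sg sh addnS.
rewrite e slice_rcons; last by move: lt; rewrite e /sg; lia.
rewrite -cats1 count_cat /= addn0.
have := break_sg hw'; rewrite /break e /= => ->; rewrite addn1; congr _.+1.
have -> : bot h.+1 - top h.+1 = (top h - top h.+1) + (bot h.+1 - top h) by lia.
rewrite iotaD count_cat subnKC//.
rewrite [X in _ + X](_ : _ = 0) ?addn0; last first.
  apply/eqP; rewrite -leqn0 leqNgt -has_count; apply/hasPn => i.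
  rewrite mem_iota => /andP[ti _]; rewrite [i < _]ltnNge ti orbF.
  by rewrite negb_and; apply/orP; right; apply/eqP; lia.
rewrite /slice count_map /sg.
have -> : top h + shift w h.+1 - (top h.+1 + shift w h.+1) = top h - top h.+1 by lia.
rewrite [top h.+1 + _]addnC iotaDl count_map; apply: eq_in_count => i.
by rewrite mem_iota subnKC// => /andP[_ lti] /=; rewrite lti orbT andbT addnC.
Qed.

(** Without a common row, all pieces of the right column are above the left
    one. *)
Lemma pieces_above_apart h : h.+1 < w -> et h.+1 < sg h ->
  pieces_above k h = size (pieces (slice a (sg h.+1) (et h.+1))).
Proof.
move=> hw apart; rewrite pieces_aboveE// size_pieces /slice count_map.
have sh : shift w h = (shift w h.+1).+1 by rewrite /shift; lia.
have -> : et h.+1 - sg h.+1 = bot h.+1 - top h.+1 by rewrite /et /sg; lia.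
rewrite /sg [top h.+1 + _]addnC iotaDl count_map; apply: eq_in_count => i.
rewrite mem_iota subnKC// => /andP[_ lti] /=.
have -> : i < top h by move: apart; rewrite /et /sg sh; lia.
by rewrite orbT andbT addnC.
Qed.

Lemma first_levelS h : h.+1 < w ->
  first_level k w h = pieces_above k h + first_level k w h.+1.
Proof.
move=> hw; rewrite /first_level big_ltn; last by lia.
by rewrite addnCA.
Qed.

(** A gap is the single piece [A(g, 1)], whose dual [A(1, g)] has one box. *)
Lemma size_dual_gap h : h.+1 < w -> et h.+1 < sg h ->
  size (dual_index (slice a (et h.+1) (sg h))) = 1.
Proof.
move=> hw apart; have hw' := ltnW hw.
have free p : et h.+1 <= p < sg h -> forall c, ~~ occupied p c.
  move=> /andP[p1 p2] c; apply/negP => /andP[le]; rewrite mem_k ltn_ord /= => tb.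
  have [hc|ch] := ltnP h c.
    have : et c <= et h.+1.
      by move: hc; rewrite leq_eqVlt => /orP[/eqP->//|/et_lt/(_ (ltn_ord c))/ltnW].
    by move: tb le p1 p2; rewrite /et /sg; lia.
  have : sg h <= sg c.
    by move: ch; rewrite leq_eqVlt => /orP[/eqP->//|/sg_lt/(_ hw')/ltnW].
  by move: tb le p1 p2; rewrite /et /sg; lia.
have aE p : et h.+1 <= p < sg h -> a p = if p.+1 == sg h then 2 else 1.
  move=> hp; rewrite diagseq_free; last exact: free.
  congr (if _ then _ else _); apply/existsP/eqP => [[c /eqP cp]|->]; last first.
    by exists (Ordinal hw').
  have [hc|ch] := ltnP h c.
    have : et c <= et h.+1.
      by move: hc; rewrite leq_eqVlt => /orP[/eqP->//|/et_lt/(_ (ltn_ord c))/ltnW].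
    by have := sg_le_et c; move: hp; lia.
  move: ch; rewrite leq_eqVlt => /orP[/eqP<-//|/sg_lt/(_ hw')].
  by move: hp; lia.
have -> : slice a (et h.+1) (sg h) = piece (sg h - et h.+1, 1).
  case e : (sg h) apart aE => [//|s] apart aE.
  rewrite slice_rcons// aE ?eqxx; last by lia.
  rewrite /piece /= subSn//=; congr rcons.
  rewrite -(size_slice a (et h.+1) s).
  apply/all_pred1P/allP => _ /mapP[i + ->] /=; rewrite mem_iota => hi.
  have [h1 h2] : et h.+1 <= i /\ i < s.
    by move: hi apart; move: (et h.+1) => u; clear; lia.
  by rewrite aE ?eqSS ?(ltn_eqF h2)// h1 ltnS (ltnW h2).
by rewrite dual_index_piece ?subn_gt0//= size_rcons.
Qed.

(** The dual of a column starts with the dual of its last piece. The steps of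
    [dual_top], increased by [1], are the lengths of the duals of the segments
    between two consecutive bottoms. *)
Lemma dual_topE c : c < w -> dual_top k w c + c = dualpos (et c).
Proof.
elim: c => [|h IH] hw.
  by rewrite /= /dualpos slice_nil.
have hw' := ltnW hw; have {}IH := IH hw'.
have eh := et_lt (ltnSn h) hw.
rewrite (dualpos_cat (break_et hw') (ltnW eh) (et_le0 hw')) -IH [LHS]/=.
rewrite /last_level; set n := size (col_pieces k h.+1).
have fl := first_levelS hw; set l := first_level k w h.+1 in fl *.
have nE : n = size (pieces (slice a (sg h.+1) (et h.+1))).
  by rewrite /n /col_pieces slice_column.
have [share|apart] := leqP (sg h) (et h.+1).
  (* The pieces of column [h] up to the bottom of column [h + 1] are common to
     both columns; the depth counts the boxes of the duals of the others. *)
  have pa := pieces_above_share hw share.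
  have sgh := ltnW (sg_lt (ltnSn h) hw).
  rewrite -(slice_cat a sgh share) pieces_cat ?last_slice ?break_sg// size_cat -pa in nE.
  have colE : col_pieces k h =
      pieces (slice a (sg h) (et h.+1)) ++ pieces (slice a (et h.+1) (et h)).
    rewrite /col_pieces slice_column// -(slice_cat a share (ltnW eh)).
    by rewrite pieces_cat// last_slice// break_et.
  have idx : (l + n).-1 - first_level k w h = size (pieces (slice a (sg h) (et h.+1))).
    by rewrite fl nE; lia.
  have last0 : 0 < size (pieces (slice a (et h.+1) (et h))).
    have := break_et hw'; rewrite size_pieces -has_count /break.
    case: (et h) eh => // e eh /= ae; apply/hasP; exists (a e) => //.
    by rewrite slice_rcons// mem_rcons mem_head.
  have -> : has_level k w (l + n).-1 h.+1 && has_level k w (l + n).-1 h.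
    rewrite /has_level -/n -/l colE size_cat fl nE; lia.
  rewrite /dual_depth idx colE drop_size_cat// -size_dual_index; last first.
    exact/admissible_slice/break_et.
  by have := size_dual_slice_gt0 (break_et hw') eh; lia.
(* The columns have no common level, and the gap accounts for the step of [1]
   from one column to the next. *)
have pa := pieces_above_apart hw apart; rewrite -nE in pa.
have -> : has_level k w (l + n).-1 h.+1 && has_level k w (l + n).-1 h = false.
  by rewrite /has_level -/n -/l fl pa; lia.
rewrite -(slice_cat a (ltnW apart) (sg_le_et h)) dual_index_cat; last first.
  exact/last_slice/break_sg.
rewrite size_cat size_dual_gap// /dual_column slice_column//; lia.
Qed.

Definition dual_seq (p : nat) : nat := nth 0 (dual_index (slice a 0 (et 0))) p.

(** Cutting the sequence at breaks cuts the dual sequence into the duals. *)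
Lemma slice_dual_seq p q : break a p -> break a q -> p <= q -> q <= et 0 ->
  slice dual_seq (dualpos q) (dualpos p) = dual_index (slice a p q).
Proof.
move=> bp bq pq qe; rewrite (dualpos_cat bq pq qe) /dualpos.
apply: (@slice_nth _ _ _ (dual_index (slice a 0 p)) 0) => i; rewrite /dual_seq.
rewrite -(slice_cat a (leq0n p) (leq_trans pq qe)) dual_index_cat ?last_slice//.
by rewrite -(slice_cat a pq qe) dual_index_cat ?last_slice// catA.
Qed.

Let top' c := dual_top k w (shift w c).
Let bot' c := top' c + size (dual_column k (shift w c)).

Lemma mem_dual_shape r c :
  ((r, c) \in dual_shape k w) = (c < w) && (top' c <= r < bot' c).
Proof.
rewrite inE /=; apply/allpairsPdep/andP => [[j [u [+ + [-> ->]]]]|[cw tb]].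
  rewrite !mem_iota /= => jw us; have jE : shift w (w.-1 - j) = j.
    by rewrite /shift; lia.
  by rewrite /top' /bot' jE /top' jE leq_addr ltn_add2l; split => //; lia.
exists (shift w c), (r - top' c); rewrite !mem_iota /= subnKC; last by case/andP: tb.
split; [rewrite /shift; lia|by move: tb; rewrite /bot'; lia|].
by congr (_, _); rewrite /shift; lia.
Qed.

Lemma sg'E c : c < w -> top' c + shift w c = dualpos (et (shift w c)).
Proof. by move=> cw; rewrite /top' dual_topE// /shift; lia. Qed.

Lemma et'E c : c < w -> bot' c + shift w c = dualpos (sg (shift w c)).
Proof.
move=> cw; rewrite /bot' addnAC sg'E// dualpos_sg//.
by rewrite /shift; lia.
Qed.

Lemma dual_tableauE (b : domf (dual_tableau k w)) :
  dual_tableau k w b = dual_seq ((val b).1 + shift w (val b).2).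
Proof.
case: b => -[r c] hb; rewrite ffunE /=; have := hb.
rewrite [in X in X -> _]/= mem_dual_shape => /andP[cw tb].
rewrite -/(shift w c); set j := shift w c in tb *.
have jw : j < w by rewrite /j /shift; lia.
have := slice_dual_seq (break_sg jw) (break_et jw) (sg_le_et j) (et_le0 jw).
rewrite -slice_column// -/(dual_column k j) => <-.
have rs : r - dual_top k w j < dualpos (sg j) - dualpos (et j).
  rewrite dualpos_sg// addKn; move: tb; rewrite /bot' /top' -/j; lia.
rewrite /slice (nth_map 0) ?size_iota// nth_iota// -dual_topE//.
by congr dual_seq; move: tb; rewrite /top' -/j; lia.
Qed.

(** The column [c] of the dual tableau is the dual of the column [shift w c], so
    that tops become bottoms and the order of the columns is reversed. *)
Lemma Osum_dual_tableau (R : realType) l :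
  Osum R k l = Osum R (dual_tableau k w) l.
Proof.
have kE (b : domf k) : k b = a ((val b).1 + shift w (val b).2).
  case: b => -[r c] hb /=; rewrite diagseqE//.
  by rewrite /entry (in_fnd hb).
have rE (i : 'I_w) : shift w (rev_ord i) = i by have := ltn_ord i; rewrite /shift /=; lia.
have shw (c : 'I_w) : shift w c < w by have := ltn_ord c; rewrite /shift; lia.
have dec (g : nat -> nat) : (forall p, p < w -> break a (g p)) ->
    (forall p, p < w -> g p <= et 0) ->
    (forall c c', c < c' -> c' < w -> g c' < g c) ->
    forall c c' : 'I_w, c < c' -> dualpos (g (shift w c')) < dualpos (g (shift w c)).
  move=> gb g0 gd c c' cc'; have lt := shift_lt cc' (ltn_ord c').
  by apply: dualpos_lt; [exact: gb|exact: gd|exact: g0].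
apply: (Osum_dual_positions R mem_k mem_dual_shape kE dual_tableauE).
- by move=> c c' /sg_lt; apply.
- by move=> c c' /et_lt; apply.
- move=> c c' cc'; rewrite !sg'E//; apply: dec cc' => //.
  + exact: break_et.
  + exact: et_le0.
  + exact: et_lt.
- move=> c c' cc'; rewrite !et'E//; apply: dec cc' => //.
  + exact: break_sg.
  + exact: sg_le0.
  + exact: sg_lt.
- by move=> c; exact: sg_le_et.
- move=> i j; rewrite sg'E// et'E// !rE; have := ltn_ord i; have := ltn_ord j => jw iw.
  have [le|lt] := leqP (sg j) (et i).
    by rewrite (dualpos_cat (break_et iw) le (et_le0 iw)) leq_addr.
  by apply/esym/negbTE; rewrite -ltnNge; apply: dualpos_lt (break_sg jw) lt (sg_le0 jw).
move=> i j le; have := ltn_ord i; have := ltn_ord j => jw iw; split.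
  exact/admissible_slice/break_et.
rewrite sg'E// et'E// !rE.
exact: slice_dual_seq (break_sg jw) (break_et iw) le (et_le0 iw).
Qed.

End DualGeometry.

(** The lengths of the columns of a Young diagram form the conjugate
    partition. *)
Lemma ltn_count_gt (s : seq nat) r c : sorted geq s ->
  (r < count (fun m => c < m) s) = (c < nth 0 s r).
Proof.
elim: s r => [|m s IH] r /=; first by rewrite nth_nil !ltn0.
move=> ms; have ss := path_sorted ms.
have [cm|mc] := ltnP c m.
  by case: r => [|r] /=; rewrite ?cm// addnC addn1 ltnS IH.
have le n : nth 0 s n <= m.
  have [h|h] := ltnP n (size s); last by rewrite nth_default.
  have geq_trans : transitive geq by move=> x y z /= h1 h2; exact: leq_trans h2 h1.
  have /allP := order_path_min geq_trans ms; apply; exact: mem_nth.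
rewrite add0n IH// !ltnNge (leq_trans (le r) mc).
by case: r => [|r] /=; rewrite ?mc// (leq_trans (le r) mc).
Qed.

Theorem theorem4p4 (R : realType) (la mu : seq nat)
    (hla : is_partition la) (hmu : is_partition mu) (hsub : part_sub mu la)
    (k : tableau) (hshape : domf k = skew_shape la mu) (hk : ID k) (l : nat) :
  Osum R k l = Osum R (dual_tableau k (head 0 la)) l.
Proof.
have [sla _] := andP hla; have [smu _] := andP hmu.
pose conj (s : seq nat) c := count (fun m => c < m) s.
have conj_mono s c c' : c <= c' -> conj s c' <= conj s c.
  by move=> cc'; apply: sub_count => m /=; exact: leq_ltn_trans.
apply: (@Osum_dual_tableau k _ (conj mu) (conj la)) => //.
- move=> r c; rewrite hshape mem_skew_shape (leqNgt (conj mu c)) !ltn_count_gt// -leqNgt.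
  have [h|] := boolP (c < nth 0 la r); rewrite ?andbF//.
  suff -> : c < head 0 la by [].
  apply: leq_trans h _; rewrite -nth0.
  have := ltn_count_gt 0 (nth 0 la r).-1 sla.
  have [->//|p0] := posnP (nth 0 la r).
  have := ltn_count_gt r (nth 0 la r).-1 sla; rewrite prednK// leqnn => h <-.
  by apply: leq_ltn_trans h.
- exact: conj_mono.
- exact: conj_mono.
move=> c; rewrite leqNgt; apply/negP => h.
have := h; rewrite ltn_count_gt// => /leq_trans/(_ (hsub _)).
by rewrite -ltn_count_gt// ltnn.
Qed.
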